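(* Let $W$ be a $2m$-dimensional real linear symplectic space with symplectic form $\sigma$, and let $\Lambda:I\to L(W)$ be a smooth rank $1$ curve of constant finite weight in the Lagrange Grassmannian $L(W)$, defined on an interval $I$. Then there exists a smooth moving Darboux frame $\bigl(E_1(t),\ldots,E_m(t),F_1(t),\ldots,F_m(t)\bigr)$, $t\in I$, of $W$ such that the following two conditions hold: 1. $\Lambda(t)=\mathrm{span}\bigl(E_1(t),\ldots,E_m(t)\bigr)$ for all $t\in I$; 2. there are smooth functions $\lambda_1,\ldots,\lambda_m$ on $I$ such that the frame satisfies the structural equation $$\left\{\begin{aligned} &E_i'(t)=E_{i+1}(t),\quad 1\leq i\leq m-1,\\ &E_m'(t)=\pm F_m(t),\\ &F_1'(t)=\lambda_m(t)E_1(t),\\ &F_i'(t)=\lambda_{m-i+1}(t)E_i(t)-F_{i-1}(t),\quad 2\leq i\leq m, \end{aligned}\right.$$ where in the second equation the sign $+$ appears if the quadratic form $\dot\Lambda(t)$ is nonnegative definite and the sign $-$ appears if the quadratic form $\dot\Lambda(t)$ is nonpositive definite. In addition, if a moving Darboux frame $\bigl(E_1(t),\ldots,E_m(t),F_1(t),\ldots,F_m(t)\bigr)$ satisfies conditions 1 and 2, then the only frame different from it which satisfies the same conditions is $\bigl(-E_1(t),\ldots,-E_m(t),-F_1(t),\ldots,-F_m(t)\bigr)$.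
   Context: $L(W)$ is the set (manifold) of all Lagrangian subspaces of $W$, i.e. $m$-dimensional subspaces $\Lambda\subset W$ with $\sigma|_\Lambda=0$. A basis $(E_1,\ldots,E_m,F_1,\ldots,F_m)$ of $W$ is called Darboux if $\sigma(E_i,E_j)=\sigma(F_i,F_j)=0$ and $\sigma(F_i,E_j)=\delta_{ij}$ for $1\le i,j\le m$. A smooth moving Darboux frame is a Darboux basis depending smoothly on $t$. Velocity: the tangent space $T_\Lambda L(W)$ is identified with the space of quadratic forms on $\Lambda$ (equivalently, self-adjoint linear maps $\Lambda\to\Lambda^*$). For a smooth curve $\Lambda(\cdot)$ in $L(W)$ and $l\in\Lambda(\tau)$, choose a smooth curve $l(\cdot)$ in $W$ with $l(t)\in\Lambda(t)$ for all $t$ and $l(\tau)=l$; then $\dot\Lambda(\tau)(l)=\sigma(l'(\tau),l)$, which depends only on $l$ and the velocity of the curve at $\tau$. Rank: $\Lambda(\cdot)$ is a rank $1$ curve if for every $t$ the velocity $\dot\Lambda(t)$ has rank $1$ as a quadratic form (self-adjoint map) on $\Lambda(t)$. Weight: given $\tau$, choose linear Darboux coordinates $W\cong\mathbb R^m\times\mathbb R^m$ such that $\Lambda(\tau)$ is transversal to $\{0\}\times\mathbb R^m$ (a Lagrangian subspace), so that for $t$ near $\tau$ one has $\Lambda(t)=\{(x,S_tx):x\in\mathbb R^m\}$ with $S_t$ a symmetric $m\times m$ matrix. The weight $k(\tau)$ of the curve at $\tau$ is the order of the zero at $t=\tau$ of the function $t\mapsto\det(S_t-S_\tau)$ (it does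 not depend on the coordinates). The curve has constant finite weight if $k(\tau)$ is finite and the same for all $\tau\in I$. *)

(* Defs.v *)
From HB Require Import structures.
From mathcomp Require Import all_boot all_order all_algebra.
From mathcomp Require Import all_classical all_reals all_analysis.

Set Implicit Arguments.
Unset Strict Implicit.
Unset Printing Implicit Defensive.

Import Order.TTheory GRing.Theory Num.Theory.
Import numFieldNormedType.Exports.

Local Open Scope classical_set_scope.
Local Open Scope ring_scope.

(* Derivatives are taken along A, so that they are one-sided at an endpoint of
   an interval A.  When A is an interval with more than one point, all the
   notions below depend only on the values of the functions on A. *)
Section CalculusWithin.
Context {R : realType} {V : normedModType R}.
Implicit Types (A : set R) (f : R -> V) (t : R).

Definition derivable_within A f t : Prop :=
  cvg ((s - t)^-1 *: (f s - f t) @[s --> within A t^']).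

Definition derive_within A f t : V :=
  lim ((s - t)^-1 *: (f s - f t) @[s --> within A t^']).

Definition derive_within_n A n f : R -> V := iter n (derive_within A) f.

Definition smooth_within A f : Prop :=
  forall n t, A t -> derivable_within A (derive_within_n A n f) t.

End CalculusWithin.

Definition zero_of_order {R : realType} (A : set R) (h : R -> R) (t : R)
    (k : nat) : Prop :=
  (forall j, (j < k)%N -> derive_within_n A j h t = 0) /\
  derive_within_n A k h t != 0.

(* A finite-dimensional space is given its usual topology through the linear
   isomorphism onto row vectors provided by a basis (any basis gives the same
   topology). *)
Section VectorCurves.
Context {R : realType} {W : vectType R}.
Implicit Types (A : set R) (c : R -> W).

Definition smooth_curve A c : Prop :=
  smooth_within A (fun t => passmx.rVof (vbasis {:W}) (c t)).

Definition curve_derive A c (t : R) : W :=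
  passmx.vecof (vbasis {:W})
    (derive_within A (fun s => passmx.rVof (vbasis {:W}) (c s)) t).

End VectorCurves.

Section QuadraticForms.
Context {R : realType} {W : vectType R}.
Implicit Types (U : {vspace W}) (q : W -> R).

Definition polar_form q (u v : W) : R := (q (u + v) - q u - q v) / 2%:R.

Definition qform_rank U q : nat :=
  \rank (\matrix_(i < \dim U, j < \dim U)
           polar_form q (tnth (vbasis U) i) (tnth (vbasis U) j)).

Definition nonneg_qform U q : Prop := {in U, forall l, 0 <= q l}.
Definition nonpos_qform U q : Prop := {in U, forall l, q l <= 0}.

End QuadraticForms.

Section LagrangeGrassmannian.
Context {R : realType} {W : vectType R} {m : nat}.
Variable sigma : {skew_symmetric W}.
Implicit Types (I : set R) (Lam : R -> {vspace W}).

Definition lagrangian (L : {vspace W}) : Prop :=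
  \dim L = m /\ {in L &, forall u v, sigma u v = 0}.

Definition darboux_basis (e f : 'I_m -> W) : Prop :=
  [/\ basis_of fullv (codom e ++ codom f),
      forall i j, sigma (e i) (e j) = 0,
      forall i j, sigma (f i) (f j) = 0 &
      forall i j, sigma (f i) (e j) = (i == j)%:R].

(* In the Darboux coordinates (x, y) |-> sum_i x_i e_i + sum_i y_i f_i,
   L = {(x, S x)}; in particular L is transversal to span f. *)
Definition is_graph (e f : 'I_m -> W) (S : 'M[R]_m) (L : {vspace W}) : Prop :=
  forall w, w \in L <->
    exists x : 'cV[R]_m,
      w = \sum_i x i 0 *: e i + \sum_i (S *m x) i 0 *: f i.

(* (e, f) is a Darboux basis whose standard chart of L(W) covers Lam near t
   (relatively to I); S is the curve read in this chart. *)
Definition smooth_chart_repr I Lam (t eps : R) (e f : 'I_m -> W)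
    (S : R -> 'M[R]_m) : Prop :=
  [/\ 0 < eps, darboux_basis e f,
      forall s, (I `&` ball t eps) s ->
        (S s)^T = S s /\ is_graph e f (S s) (Lam s) &
      smooth_within (I `&` ball t eps) S].

Definition smooth_lagrangian_curve I Lam : Prop :=
  (forall t, I t -> lagrangian (Lam t)) /\
  (forall t, I t -> exists eps e f S, smooth_chart_repr I Lam t eps e f S).

(* The value at l in Lam t of the quadratic form that is the velocity of Lam
   at t: sigma (c' t) l for any smooth c through l lying in Lam. *)
Definition velocity I Lam (t : R) (l : W) : R :=
  xget 0 [set q | exists c : R -> W,
    [/\ smooth_curve I c, forall s, I s -> c s \in Lam s, c t = l &
        q = sigma (curve_derive I c t) l]].

Definition rank1_curve I Lam : Prop :=
  forall t, I t -> qform_rank (Lam t) (velocity I Lam t) = 1%N.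

Definition has_weight I Lam (t : R) (k : nat) : Prop :=
  exists eps e f S, smooth_chart_repr I Lam t eps e f S /\
    zero_of_order (I `&` ball t eps) (fun s => \det (S s - S t)) t k.

Definition constant_finite_weight I Lam : Prop :=
  exists k, forall t, I t -> has_weight I Lam t k.

Definition moving_darboux_frame I (E F : 'I_m -> R -> W) : Prop :=
  [/\ forall i, smooth_curve I (E i), forall i, smooth_curve I (F i) &
      forall t, I t -> darboux_basis (E^~ t) (F^~ t)].

(* Indices are shifted by one: i : 'I_m stands for i + 1, so that the last
   index is the one with i.+1 = m, and lambda_{m-i+1} is indexed by rev_ord. *)
Definition structural_equation I Lam (E F : 'I_m -> R -> W) : Prop :=
  exists (s : R) (lam : 'I_m -> R -> R),
    [/\ s = 1 \/ s = - 1,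
        forall t, I t ->
          (nonneg_qform (Lam t) (velocity I Lam t) -> s = 1) /\
          (nonpos_qform (Lam t) (velocity I Lam t) -> s = - 1),
        forall i, smooth_within I (lam i) &
        forall t, I t ->
        [/\ forall i j : 'I_m, j = i.+1 :> nat ->
              curve_derive I (E i) t = E j t,
            forall i : 'I_m, i.+1 = m ->
              curve_derive I (E i) t = s *: F i t,
            forall i : 'I_m, i = 0%N :> nat ->
              curve_derive I (F i) t = lam (rev_ord i) t *: E i t &
            forall i j : 'I_m, j = i.+1 :> nat ->
              curve_derive I (F j) t = lam (rev_ord j) t *: E j t - F i t]].

Definition normal_darboux_frame I Lam (E F : 'I_m -> R -> W) : Prop :=
  [/\ moving_darboux_frame I E F,
      forall t, I t -> Lam t = <<codom (E^~ t)>>%VS &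
      structural_equation I Lam E F].

End LagrangeGrassmannian.

Arguments smooth_lagrangian_curve {R W} m sigma I Lam.
Arguments constant_finite_weight {R W} m sigma I Lam.

Definition same_frame_on {R : realType} {W : vectType R} {m : nat} (I : set R)
    (E F E' F' : 'I_m -> R -> W) : Prop :=
  forall t, I t -> forall i, E' i t = E i t /\ F' i t = F i t.

(* Main.v *)
Require Import Defs.
From mathcomp Require Import all_boot all_order all_algebra.
From mathcomp Require Import all_classical all_reals all_analysis.
From mathcomp Require Import ring lra zify.

(** In a Darboux chart the curve is a family of graphs of symmetric matrices
    S t, its velocity is the quadratic form of the derivative S' t, and rank 1
    means that S' = sg v v^T with sg = 1 or -1 and v a smooth vector function.

    A normal frame is determined by its first vector: the structural equation
    says that E_1, E_1', ..., E_1^(m-1) stay in Lam and that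
    sigma(E_1^(m), E_1^(m-1)) is 1 or -1.  Call such a curve in W generating.
    In the chart, E_1 = (x, S x), and the conditions become: x is orthogonal
    to v, v', ..., v^(m-2), and its product with v^(m-1) is 1 or -1.  Hence
    local generating curves exist as soon as the Wronskian matrix
    (v, v', ..., v^(m-1)) is invertible (local_generating).

    The invertibility follows from the constancy of the weight
    (wronskian_neq0).  If D t is the Wronskian determinant, then
    det (S s - S t) is equivalent to a (D t)^2 (s - t)^(m^2) for s close to t,
    where a <> 0 comes from the determinant of a Hilbert matrix
    (det_primitive_asymptotics).  So the weight is m^2 where D does not vanish
    and is larger elsewhere.  If D vanished on an interval, v would stay in a
    constant proper subspace on a smaller interval (wronskian0_dependent),
    det (S s - S t) would vanish there, and the weight would be infinite.
    Hence the weight is m^2 at some point, so everywhere.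

    Let c and d be generating curves.  Differentiating the relations
    sigma(c^(i), d^(j)) = 0, valid for i, j < m, gives the same relations for
    i + j < 2m - 1, and makes the values for i + j = 2m - 1 agree up to sign.
    Therefore c, c', ..., c^(2m-1) is a basis of W and d is a multiple of c;
    the normalization leaves only the factors 1 and -1 (generating_unique).
    Consequently local generating curves can be glued along the interval
    (generating_exists).

    From a generating curve, E_i is its derivative of order i - 1 and
    F_m = s E_m' with s = 1 or -1.  The remaining vectors are
    F_(i-1) = lambda E_i - F_i', where sigma(F_(i-1), F_i) = 0 forces lambda.
    Differentiating the pairings between these vectors shows that they form a
    Darboux basis and that F_1' is a multiple of E_1
    (generated_normal_frame).  The coefficients being forced, two normal frames
    differ by the same sign as their first vectors (normal_frame_unique). *)

Set Implicit Arguments.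
Unset Strict Implicit.
Unset Printing Implicit Defensive.

Import Order.TTheory GRing.Theory Num.Theory.
Import numFieldNormedType.Exports.

Local Open Scope classical_set_scope.
Local Open Scope ring_scope.

(** * Intervals and relatively open subintervals *)

Section Domains.
Context {R : realType}.
Implicit Types (A I J : set R) (t : R).

Definition proper_interval A :=
  is_interval A /\ exists a b, [/\ A a, A b & a < b].

Definition rel_open J I :=
  J `<=` I /\ forall t, J t -> \forall s \near t, I s -> J s.

Lemma within_dnbhs_proper A t : proper_interval A -> A t ->
  ProperFilter (within A t^').
Proof.
move=> [iA [a [b [Aa Ab ab]]]] At.
apply: Build_ProperFilter_ex => P.
rewrite /within /= /dnbhs /within /= => /nbhs_ballP[e /= e0 He].
(* A contains a point u <> t, hence the segment from t to u; r is chosen so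
   that t + r (u - t) is at distance less than e from t. *)
have [u Au ut] : exists2 u, A u & u != t.
  have [ta|ta] := eqVneq a t; last by exists a.
  by exists b => //; rewrite -ta gt_eqF.
pose r : R := Num.min 1 (e / (2 * `|u - t|)).
have ut0 : 0 < `|u - t| by rewrite normr_gt0 subr_eq0.
have r0 : 0 < r by rewrite lt_min ltr01 divr_gt0// mulr_gt0.
have r1 : r <= 1 by rewrite ge_min lexx.
have re : r * `|u - t| < e.
  apply: (@le_lt_trans _ _ (e / 2)); last by lra.
  have : r <= e / (2 * `|u - t|) by rewrite ge_min lexx orbT.
  rewrite -(ler_pM2r ut0) => /le_trans; apply.
  by rewrite invfM -!mulrA mulVf ?gt_eqF// mulr1.
exists (t + r * (u - t)); apply: He.
- by rewrite /ball /= opprD addNKr normrN normrM (gtr0_norm r0).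
- by rewrite -subr_eq0 addrAC subrr add0r mulf_neq0 ?subr_eq0// gt_eqF.
- have [tu|ut'] := leP t u.
    apply: (iA t u) => //.
    by apply/andP; split; nra.
  apply: (iA u t) => //.
  by apply/andP; split; nra.
Qed.

Lemma within_dnbhs_rel_open J I t : rel_open J I -> J t ->
  within J t^' = within I t^'.
Proof.
move=> [JI oJ] Jt; apply/seteqP; split => P; rewrite /within /=; last first.
  by apply: filterS => s H /JI.
have := oJ t Jt => /(@nbhs_dnbhs _ t); apply: filterS2 => s IJ H /IJ.
exact: H.
Qed.

Lemma rel_open_refl I : rel_open I I.
Proof. by split => // t _; near=> s. Unshelve. all: by end_near. Qed.

Lemma rel_open_trans K J I : rel_open K J -> rel_open J I -> rel_open K I.
Proof.
move=> [KJ oK] [JI oJ]; split; first by move=> x /KJ /JI.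
move=> t Kt; have := oJ t (KJ _ Kt); have := oK t Kt.
by apply: filterS2 => s h1 h2 /h2.
Qed.

Lemma rel_open_setI I (B : set R) : open B -> rel_open (I `&` B) I.
Proof.
move=> oB; split; first by move=> x [].
move=> t [It Bt]; have := open_nbhs_nbhs (conj oB Bt).
by apply: filterS.
Qed.

Lemma rel_open_sub K J I : rel_open K I -> K `<=` J -> J `<=` I -> rel_open K J.
Proof.
move=> [KI oK] KJ JI; split => // t /oK; apply: filterS => s h /JI; exact: h.
Qed.

Lemma is_intervalI A B : is_interval A -> is_interval B ->
  is_interval (A `&` B).
Proof.
move=> iA iB x y [Ax Bx] [Ay By] z xzy.
by split; [apply: (iA x y)|apply: (iB x y)].
Qed.

Lemma is_interval_ball (t e : R) : is_interval (ball t e).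
Proof.
move=> x y /= + + z /andP[xz zy]; rewrite /ball /=.
by rewrite !ltr_norml => /andP[? ?] /andP[? ?]; apply/andP; split; lra.
Qed.

Lemma rel_open_proper J I : proper_interval I -> rel_open J I ->
  is_interval J -> J !=set0 -> proper_interval J.
Proof.
move=> pI oJ iJ [t Jt]; split => //.
have It := oJ.1 _ Jt.
have FF := within_dnbhs_proper pI It.
rewrite -(within_dnbhs_rel_open oJ Jt) in FF.
have [s [Js st]] : exists s, J s /\ s != t.
  apply: (@filter_ex _ (within J t^')).
  rewrite /within /=; near=> s => Js; split => //.
  by near: s; exact: nbhs_dnbhs_neq.
have [lt_st|le_ts] := ltP s t; first by exists s, t.
by exists t, s; split => //; rewrite lt_neqAle eq_sym st.
Unshelve. all: by end_near. Qed.

Lemma proper_interval_ball I t e : proper_interval I -> I t -> 0 < e ->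
  proper_interval (I `&` ball t e).
Proof.
move=> pI It e0; apply: (rel_open_proper pI).
- exact/rel_open_setI/ball_open.
- by apply: is_intervalI; [exact: pI.1|exact: is_interval_ball].
- by exists t; split => //; exact: ballxx.
Qed.

(** The points of I where Q holds form a subset that is open and closed in I,
    and I is connected. *)
Lemma interval_ind I (Q : R -> Prop) t0 : is_interval I -> I t0 -> Q t0 ->
  (forall t, I t -> \forall s \near t, I s -> (Q s <-> Q t)) ->
  forall t, I t -> Q t.
Proof.
move=> /connected_intervalP cI It0 Q0 loc.
suff E : I `&` Q = I by move=> t; rewrite -{1}E => -[].
apply: (cI (I `&` Q)).
- by exists t0.
- exists (\bigcup_(B in [set B | open B /\ I `&` B `<=` Q]) B).
    by apply: bigcup_open => B [].
  apply/seteqP; split => s; last first.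
    by move=> [Is [B [oB BQ] Bs]]; split => //; apply: BQ.
  move=> [Is Qs]; split => //.
  have : nbhs s (fun x => I x -> (Q x <-> Q s)) by exact: loc.
  rewrite nbhsE => -[B [oB Bs] BH].
  by exists B => //; split => // x [Ix /BH] /(_ Ix) [_]; apply.
- exists (~` (\bigcup_(B in [set B | open B /\ I `&` B `<=` ~` Q]) B)).
    by apply: open_closedC; apply: bigcup_open => B [].
  apply/seteqP; split => s.
    move=> [Is Qs]; split => // -[B [oB BQ] Bs].
    exact: (BQ s).
  move=> [Is H]; split => //; apply: contrapT => nQs; apply: H.
  have : nbhs s (fun x => I x -> (Q x <-> Q s)) by exact: loc.
  rewrite nbhsE => -[B [oB Bs] BH].
  exists B => //; split => // x [Ix /BH] /(_ Ix) [h _] /h; exact: nQs.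
Qed.

End Domains.

(** * Derivatives along a set: locality and entries *)

Section Locality.
Context {R : realType} {V : normedModType R}.
Implicit Types (A I J : set R) (t : R) (f g : R -> V).

Lemma quotient_within_local J I f g t : rel_open J I -> J t ->
    (forall s, J s -> f s = g s) ->
  ((s - t)^-1 *: (f s - f t) @[s --> within J t^']) =
  ((s - t)^-1 *: (g s - g t) @[s --> within I t^']).
Proof.
move=> oJ Jt fg; rewrite -(within_dnbhs_rel_open oJ Jt).
have fgn : \forall s \near within J t^',
    (s - t)^-1 *: (f s - f t) = (s - t)^-1 *: (g s - g t).
  have : within J t^' J by exact: withinT.
  by apply: filterS => s Js; rewrite !fg.
apply/seteqP; split => P.
- by apply: (near_eq_cvg (F := within J t^')); exact: fgn.
- apply: (near_eq_cvg (F := within J t^')).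
  by apply: filterS fgn => s ->.
Qed.

(** Iterated derivatives at t only see a neighbourhood of t in the domain.  This
    is what allows passing from the domain of a chart to the whole interval. *)
Lemma derive_within_n_local J I f g n t : rel_open J I ->
    (forall s, J s -> f s = g s) -> J t ->
  derive_within_n J n f t = derive_within_n I n g t.
Proof.
move=> oJ fg; elim: n t => [|n IH] t Jt /=; first exact: fg.
by rewrite /derive_within (quotient_within_local oJ Jt IH).
Qed.

Lemma derive_within_local J I f g t : rel_open J I ->
    (forall s, J s -> f s = g s) -> J t ->
  derive_within J f t = derive_within I g t.
Proof. by move=> oJ fg Jt; exact: (@derive_within_n_local J I f g 1). Qed.

Lemma derivable_within_local J I f g t : rel_open J I ->
    (forall s, J s -> f s = g s) -> J t ->
  derivable_within J f t = derivable_within I g t.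
Proof.
by move=> oJ fg Jt; rewrite /derivable_within (quotient_within_local oJ Jt fg).
Qed.

Lemma smooth_within_local J I f g : rel_open J I ->
    (forall s, J s -> f s = g s) ->
  smooth_within I g -> smooth_within J f.
Proof.
move=> oJ fg sg n t Jt; have := sg n t (oJ.1 _ Jt).
rewrite (derivable_within_local (g := derive_within_n I n g) oJ)// => s.
exact: derive_within_n_local.
Qed.

Lemma smooth_within_glue I f :
  (forall t, I t -> exists J g, [/\ rel_open J I, J t, smooth_within J g &
     forall s, J s -> f s = g s]) ->
  smooth_within I f.
Proof.
move=> loc n t It; have [J [g [oJ Jt sg fg]]] := loc t It.
have := sg n t Jt.
rewrite (derivable_within_local (g := derive_within_n I n f) oJ)// => s Js.
exact: (derive_within_n_local _ oJ (fun s Js => esym (fg s Js))).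
Qed.

Lemma smooth_within_derive I f : smooth_within I f ->
  smooth_within I (derive_within I f).
Proof.
by move=> sf n t It; have := sf n.+1 t It; rewrite /derive_within_n iterSr.
Qed.

End Locality.

Section Entries.
Context {R : realType} {p q : nat}.
Implicit Types (A : set R) (t : R) (f : R -> 'M[R]_(p, q)).

Lemma cvg_mxP (T : Type) (F : set_system T) (FF : Filter F)
    (f : T -> 'M[R]_(p, q)) (l : 'M[R]_(p, q)) :
  f x @[x --> F] --> l <-> forall i j, f x i j @[x --> F] --> l i j.
Proof.
split=> [fl i j|fl].
  by have := cvg_comp _ _ fl (@coord_continuous R p q i j l); exact.
apply/cvgrPdist_le => /= e e0; near=> x.
rewrite /Num.Def.normr/= mx_normrE (bigmax_le _ (ltW e0))//= => i _.
rewrite !mxE/=; move: i; near: x; apply: filter_forall => /= i.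
exact: ((cvgrPdist_le _ _).1 (fl i.1 i.2)).
Unshelve. all: by end_near. Qed.

Lemma derivable_within_entries A f t : proper_interval A -> A t ->
  derivable_within A f t <->
  forall i j, derivable_within A (fun s => f s i j) t.
Proof.
move=> pA At; have FF := within_dnbhs_proper pA At.
rewrite /derivable_within; split=> [/cvg_ex[l] /cvg_mxP fl i j|fl].
  apply/cvg_ex; exists (l i j); have := fl i j.
  by under eq_fun do rewrite !mxE.
apply/cvg_ex; exists (\matrix_(i, j) derive_within A (fun s => f s i j) t).
apply/cvg_mxP => i j; rewrite mxE; have := fl i j.
by under [in X in _ -> X]eq_fun do rewrite !mxE.
Qed.

Lemma derive_within_entries A f t i j : proper_interval A -> A t ->
  derivable_within A f t ->
  derive_within A f t i j = derive_within A (fun s => f s i j) t.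
Proof.
move=> pA At /cvg_ex[l fl]; have FF := within_dnbhs_proper pA At.
rewrite /derive_within (cvg_lim _ fl)//; apply/esym/cvg_lim => //.
move/cvg_mxP : fl => /(_ i j).
by under eq_fun do rewrite !mxE.
Qed.

Lemma derive_within_n_entries A f n t : proper_interval A ->
  (forall i j, smooth_within A (fun s => f s i j)) -> A t ->
  derivable_within A (derive_within_n A n f) t /\
  forall i j,
    derive_within_n A n f t i j = derive_within_n A n (fun s => f s i j) t.
Proof.
move=> pA sf; elim: n t => [|n IH] t At.
  split => //; apply/derivable_within_entries => // i' j'.
  exact: (sf i' j' 0%N).
have E u i j : A u -> derive_within_n A n.+1 f u i j =
    derive_within_n A n.+1 (fun s => f s i j) u.
  move=> Au /=; rewrite derive_within_entries//; last by case: (IH u Au).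
  by apply: (derive_within_local (rel_open_refl A)) => // s /IH[].
split; last by move=> i j; exact: E.
apply/derivable_within_entries => // i j.
rewrite (derivable_within_local (rel_open_refl A) (fun s => @E s i j))//.
exact: (sf i j n.+1).
Qed.

Lemma smooth_within_entries A f : proper_interval A ->
  smooth_within A f <-> forall i j, smooth_within A (fun s => f s i j).
Proof.
move=> pA; split => [sf i j|sf n t At].
  have E n u : A u -> derive_within_n A n f u i j =
      derive_within_n A n (fun s => f s i j) u.
    elim: n u => [|n IH] u Au //=.
    rewrite derive_within_entries//; last exact: sf.
    exact: (derive_within_local (rel_open_refl A)).
  move=> n t At; have := sf n t At.
  move=> /(derivable_within_entries _ pA At)/(_ i j).
  rewrite (derivable_within_local (g := derive_within_n A n (fun s => f s i j))
    (rel_open_refl A))// => s.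
  exact: E.
by have [] := derive_within_n_entries n pA sf At.
Qed.

End Entries.

(** * Calculus of derivatives along an interval *)

Section CvgCongr.
Context {R : realType} {T : Type} {F : set_system T} {FF : Filter F}.

Lemma cvg_near_eq (f g : T -> R) (l : R) :
  (\forall x \near F, f x = g x) -> f x @[x --> F] --> l ->
  g x @[x --> F] --> l.
Proof.
move=> fg; apply: cvg_trans; apply: near_eq_cvg.
by apply: filterS fg => x ->.
Qed.

End CvgCongr.

Section ScalarDerivative.
Context {R : realType}.
Variable A : set R.
Hypothesis pA : proper_interval A.
Implicit Types (t : R) (f g : R -> R).

Definition is_derive_within t f l :=
  (s - t)^-1 *: (f s - f t) @[s --> within A t^'] --> (l : R).

Lemma is_derive_withinP t f l : A t ->
  is_derive_within t f l <-> derivable_within A f t /\ derive_within A f t = l.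
Proof.
move=> At; have FF := within_dnbhs_proper pA At; split=> [fl|[df <-]].
  by split; [apply/cvg_ex; exists l|exact: cvg_lim].
exact: df.
Qed.

Lemma derivable_withinP t f : A t -> derivable_within A f t ->
  is_derive_within t f (derive_within A f t).
Proof. by move=> At df; apply/is_derive_withinP. Qed.

Lemma near_within_neq t : \forall s \near within A t^', A s /\ s != t.
Proof.
have : within A t^' (fun s => s != t).
  by rewrite /within /=; near=> s => _; near: s; exact: nbhs_dnbhs_neq.
have : within A t^' A by exact: withinT.
by apply: filterS2 => s.
Unshelve. all: by end_near. Qed.

Lemma is_derive_within_eq t f g l : A t -> (forall s, A s -> f s = g s) ->
  is_derive_within t f l -> is_derive_within t g l.
Proof.
by move=> At fg; rewrite /is_derive_within
  (quotient_within_local (rel_open_refl A) At fg).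
Qed.

Lemma cvg_within_id t : s @[s --> within A t^'] --> t.
Proof.
apply: (@cvg_trans _ (s @[s --> t^'])); last exact: nbhs_dnbhs.
apply: cvg_app; exact: cvg_within.
Qed.

Lemma is_derive_within_cvg t f l : A t -> is_derive_within t f l ->
  f s @[s --> within A t^'] --> f t.
Proof.
move=> At fl; have FF := within_dnbhs_proper pA At.
have cc (c : R) : (fun=> c) @ within A t^' --> c by exact: cvg_cst.
rewrite -[X in _ --> X]addr0 -(mul0r l) -(subrr t).
apply: cvg_near_eq (cvgD (cc (f t)) (cvgM (cvgB (@cvg_within_id t) (cc t)) fl)).
apply: filterS (near_within_neq t) => s [_ st].
by rewrite /GRing.scale /= mulrA mulfV ?subr_eq0// mul1r subrKC.
Qed.

Lemma is_derive_withinD t f g l m : A t -> is_derive_within t f l ->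
  is_derive_within t g m -> is_derive_within t (fun s => f s + g s) (l + m).
Proof.
move=> At fl gm; have FF := within_dnbhs_proper pA At.
apply: cvg_near_eq (cvgD fl gm); near=> s.
by rewrite -[LHS]scalerDr opprD addrACA.
Unshelve. all: by end_near. Qed.

Lemma is_derive_within_cst t (c : R) : A t -> is_derive_within t (fun=> c) 0.
Proof.
move=> At; have FF := within_dnbhs_proper pA At.
rewrite /is_derive_within; under eq_fun do rewrite subrr scaler0.
exact: cvg_cst.
Qed.

Lemma is_derive_within_id t : A t -> is_derive_within t (fun s => s) 1.
Proof.
move=> At; have FF := within_dnbhs_proper pA At.
have : (fun=> 1 : R) @ within A t^' --> (1 : R) by exact: cvg_cst.
apply: cvg_near_eq.
apply: filterS (near_within_neq t) => s [_ st].
by rewrite /GRing.scale /= mulVf// subr_eq0.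
Qed.

Lemma is_derive_withinM t f g l m : A t -> is_derive_within t f l ->
  is_derive_within t g m ->
  is_derive_within t (fun s => f s * g s) (l * g t + f t * m).
Proof.
move=> At fl gm; have FF := within_dnbhs_proper pA At.
have gc := is_derive_within_cvg At gm.
have fc : (fun=> f t) @ within A t^' --> f t by exact: cvg_cst.
apply: cvg_near_eq (cvgD (cvgM fl gc) (cvgM fc gm)); near=> s.
rewrite /GRing.scale /=; ring.
Unshelve. all: by end_near. Qed.

Lemma is_derive_withinV t f l : A t -> f t != 0 -> is_derive_within t f l ->
  is_derive_within t (fun s => (f s)^-1) (- (l / (f t * f t))).
Proof.
move=> At ft fl; have FF := within_dnbhs_proper pA At.
have fc := is_derive_within_cvg At fl.
have fVc : (f s)^-1 @[s --> within A t^'] --> (f t)^-1 by exact: cvgV.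
have cc : (fun=> (f t)^-1) @ within A t^' --> (f t)^-1 by exact: cvg_cst.
rewrite invfM; apply: cvg_near_eq (cvgN (cvgM fl (cvgM fVc cc))).
have : \forall s \near within A t^', f s != 0.
  exact: (cvgr_neq0 _ fc ft).
apply: filterS => s fs.
change (- ((s - t)^-1 * (f s - f t) * ((f s)^-1 * (f t)^-1)) =
  (s - t)^-1 * ((f s)^-1 - (f t)^-1)).
by rewrite -mulrA -mulrN; congr (_ * _); field; apply/andP.
Qed.

Lemma is_derive_within_sqrt t f l : A t -> 0 < f t -> is_derive_within t f l ->
  is_derive_within t (fun s => Num.sqrt (f s)) (l / (2 * Num.sqrt (f t))).
Proof.
move=> At ft fl; have FF := within_dnbhs_proper pA At.
have fc := is_derive_within_cvg At fl.
have sc : Num.sqrt (f s) @[s --> within A t^'] --> Num.sqrt (f t).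
  by have := cvg_comp _ _ fc (@sqrt_continuous R (f t)); exact.
have cc : (fun=> Num.sqrt (f t)) @ within A t^' --> Num.sqrt (f t).
  exact: cvg_cst.
have st : 0 < Num.sqrt (f t) by rewrite sqrtr_gt0.
have s2 : Num.sqrt (f t) + Num.sqrt (f t) != 0 by rewrite gt_eqF// addr_gt0.
rewrite mulr_natl mulr2n; apply: cvg_near_eq (cvgM fl (cvgV s2 (cvgD sc cc))).
have : \forall s \near within A t^', 0 < f s.
  exact: (cvgr_gt _ fc _ ft).
apply: filterS => s fs.
change ((s - t)^-1 * (f s - f t) * (Num.sqrt (f s) + Num.sqrt (f t))^-1 =
  (s - t)^-1 * (Num.sqrt (f s) - Num.sqrt (f t))).
have ss : 0 < Num.sqrt (f s) by rewrite sqrtr_gt0.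
rewrite -mulrA; congr (_ * _).
rewrite -{1}(sqr_sqrtr (ltW fs)) -{1}(sqr_sqrtr (ltW ft)).
by rewrite /= subr_sqr mulfK// gt_eqF// addr_gt0.
Qed.

End ScalarDerivative.

Section Smoothness.
Context {R : realType}.
Variable A : set R.
Hypothesis pA : proper_interval A.
Implicit Types (t : R) (f g : R -> R).

(** Differentiability up to a finite order: smoothness is obtained by proving
    differentiability up to every order by induction on the order. *)
Definition diff_upto n f := forall j t, (j < n)%N -> A t ->
  derivable_within A (derive_within_n A j f) t.

Lemma smooth_diff_upto f : smooth_within A f <-> forall n, diff_upto n f.
Proof.
split=> [sf n j t _ At|df n t At]; first exact: sf.
exact: (df n.+1).
Qed.

Lemma diff_upto0 f : diff_upto 0 f.
Proof. by move=> j t; rewrite ltn0. Qed.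

Lemma diff_upto_eq n f g : (forall t, A t -> f t = g t) -> diff_upto n f ->
  diff_upto n g.
Proof.
move=> fg df j t jn At; have := df j t jn At.
rewrite (derivable_within_local (g := derive_within_n A j g)
  (rel_open_refl A))// => s.
exact: derive_within_n_local (rel_open_refl A) fg.
Qed.

Lemma diff_upto_le n p f : (p <= n)%N -> diff_upto n f -> diff_upto p f.
Proof. by move=> pn df j t jp; apply: df; exact: leq_trans pn. Qed.

Lemma diff_uptoS n f : diff_upto n.+1 f <->
  (forall t, A t -> derivable_within A f t) /\ diff_upto n (derive_within A f).
Proof.
split=> [df|[df ddf] [|j] t jn At].
- split=> [t|j t jn] At; first exact: (df 0%N).
  by have := df j.+1 t jn At; rewrite /derive_within_n iterSr.
- exact: df.
- by rewrite /derive_within_n iterSr; exact: ddf.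
Qed.

Lemma diff_uptoS_of n f g :
  (forall t, A t -> is_derive_within A t f (g t)) -> diff_upto n g ->
  diff_upto n.+1 f.
Proof.
move=> fg dg; apply/diff_uptoS; split=> [t At|].
  by have /(is_derive_withinP pA)[] := fg _ At.
apply: diff_upto_eq dg => t At.
by have /(is_derive_withinP pA)[] := fg _ At.
Qed.

Lemma diff_upto_derive n f t : diff_upto n.+1 f -> A t ->
  is_derive_within A t f (derive_within A f t).
Proof.
by move=> /diff_uptoS[df _] At; apply/(is_derive_withinP pA) => //; split=> //; exact: df.
Qed.

Lemma diff_upto_cst n (c : R) : diff_upto n (fun=> c).
Proof.
elim: n c => [c|n IH c]; first exact: diff_upto0.
 apply: (diff_uptoS_of (g := fun=> 0)) => // t.
exact: is_derive_within_cst.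
Qed.

Lemma diff_upto_id n : diff_upto n (fun s => s).
Proof.
case: n => [|n]; first exact: diff_upto0.
 apply: (diff_uptoS_of (g := fun=> 1)) => [t|].
  exact: is_derive_within_id.
exact: diff_upto_cst.
Qed.

Lemma diff_uptoD n f g : diff_upto n f -> diff_upto n g ->
  diff_upto n (fun s => f s + g s).
Proof.
elim: n f g => [f g _ _|n IH f g df dg]; first exact: diff_upto0.
apply: (diff_uptoS_of
  (g := fun t => derive_within A f t + derive_within A g t)) => [t At|].
  exact: is_derive_withinD (diff_upto_derive df At) (diff_upto_derive dg At).
have /diff_uptoS[_ ddf] := df; have /diff_uptoS[_ ddg] := dg.
exact: IH ddf ddg.
Qed.

Lemma diff_uptoM n f g : diff_upto n f -> diff_upto n g ->
  diff_upto n (fun s => f s * g s).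
Proof.
elim: n f g => [f g _ _|n IH f g df dg]; first exact: diff_upto0.
apply: (diff_uptoS_of (g := fun t =>
    derive_within A f t * g t + f t * derive_within A g t)) => [t At|].
  exact: is_derive_withinM (diff_upto_derive df At) (diff_upto_derive dg At).
have /diff_uptoS[_ ddf] := df; have /diff_uptoS[_ ddg] := dg.
exact: diff_uptoD (IH _ _ ddf (diff_upto_le (leqnSn n) dg))
  (IH _ _ (diff_upto_le (leqnSn n) df) ddg).
Qed.

(** The derivative of the inverse is a product of f' and of two copies of the
    inverse itself, so the induction gains one order; the square root below is
    treated in the same way. *)
Lemma diff_uptoV n f : (forall t, A t -> f t != 0) -> diff_upto n f ->
  diff_upto n (fun s => (f s)^-1).
Proof.
move=> f0; elim: n => [_|n IH df]; first exact: diff_upto0.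
apply: (diff_uptoS_of (g := fun t =>
    -1 * (derive_within A f t * ((f t)^-1 * (f t)^-1)))) => [t At|].
  rewrite mulN1r -invfM.
  exact: is_derive_withinV (f0 t At) (diff_upto_derive df At).
have /diff_uptoS[_ ddf] := df.
have iV := IH (diff_upto_le (leqnSn n) df).
exact: diff_uptoM (@diff_upto_cst n (-1)) (diff_uptoM ddf (diff_uptoM iV iV)).
Qed.

Lemma diff_upto_sqrt n f : (forall t, A t -> 0 < f t) -> diff_upto n f ->
  diff_upto n (fun s => Num.sqrt (f s)).
Proof.
move=> f0; elim: n => [_|n IH df]; first exact: diff_upto0.
apply: (diff_uptoS_of (g := fun t =>
    derive_within A f t * (2 * Num.sqrt (f t))^-1)) => [t At|].
  exact: is_derive_within_sqrt (f0 t At) (diff_upto_derive df At).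
have /diff_uptoS[_ ddf] := df.
apply: diff_uptoM ddf (diff_uptoV _ _).
  by move=> t At; rewrite mulf_neq0// gt_eqF// sqrtr_gt0 f0.
exact: diff_uptoM (@diff_upto_cst n 2) (IH (diff_upto_le (leqnSn n) df)).
Qed.

Lemma smooth_eq f g : (forall t, A t -> f t = g t) -> smooth_within A f ->
  smooth_within A g.
Proof.
move=> fg; apply: smooth_within_local (rel_open_refl A) _ => t At.
by rewrite fg.
Qed.

Lemma smooth_cst (c : R) : smooth_within A (fun=> c).
Proof. by apply/smooth_diff_upto => n; exact: diff_upto_cst. Qed.

Lemma smooth_id : smooth_within A (fun s : R => s).
Proof. by apply/smooth_diff_upto => n; exact: diff_upto_id. Qed.

Lemma smoothD f g : smooth_within A f -> smooth_within A g ->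
  smooth_within A (fun s => f s + g s).
Proof.
by move=> /smooth_diff_upto df /smooth_diff_upto dg; apply/smooth_diff_upto => n;
  exact: diff_uptoD.
Qed.

Lemma smoothM f g : smooth_within A f -> smooth_within A g ->
  smooth_within A (fun s => f s * g s).
Proof.
by move=> /smooth_diff_upto df /smooth_diff_upto dg; apply/smooth_diff_upto => n;
  exact: diff_uptoM.
Qed.

Lemma smoothV f : (forall t, A t -> f t != 0) -> smooth_within A f ->
  smooth_within A (fun s => (f s)^-1).
Proof.
by move=> f0 /smooth_diff_upto df; apply/smooth_diff_upto => n; exact: diff_uptoV.
Qed.

Lemma smooth_sqrt f : (forall t, A t -> 0 < f t) -> smooth_within A f ->
  smooth_within A (fun s => Num.sqrt (f s)).
Proof.
by move=> f0 /smooth_diff_upto df; apply/smooth_diff_upto => n;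
  exact: diff_upto_sqrt.
Qed.

Lemma smoothZ c f : smooth_within A f -> smooth_within A (fun s => c * f s).
Proof. exact: smoothM (@smooth_cst c). Qed.

Lemma smoothN f : smooth_within A f -> smooth_within A (fun s => - f s).
Proof.
move=> sf; apply: (@smooth_eq (fun s => -1 * f s)) => [t _|].
  by rewrite mulN1r.
exact: smoothM (@smooth_cst _) sf.
Qed.

Lemma smoothB f g : smooth_within A f -> smooth_within A g ->
  smooth_within A (fun s => f s - g s).
Proof. by move=> sf sg; exact: smoothD sf (smoothN sg). Qed.

Lemma smooth_sum (T : Type) (r : seq T) (P : pred T) (F : T -> R -> R) :
  (forall i, P i -> smooth_within A (F i)) ->
  smooth_within A (fun s => \sum_(i <- r | P i) F i s).
Proof.
move=> sF; elim: r => [|i r IH].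
  by under eq_fun do rewrite big_nil; exact: smooth_cst.
under eq_fun do rewrite big_cons.
by case: (boolP (P i)) => [Pi|_]; [exact: smoothD (sF _ Pi) IH|exact: IH].
Qed.

Lemma smooth_prod (T : Type) (r : seq T) (P : pred T) (F : T -> R -> R) :
  (forall i, P i -> smooth_within A (F i)) ->
  smooth_within A (fun s => \prod_(i <- r | P i) F i s).
Proof.
move=> sF; elim: r => [|i r IH].
  by under eq_fun do rewrite big_nil; exact: smooth_cst.
under eq_fun do rewrite big_cons.
by case: (boolP (P i)) => [Pi|_]; [exact: smoothM (sF _ Pi) IH|exact: IH].
Qed.

Lemma smoothX f n : smooth_within A f -> smooth_within A (fun s => f s ^+ n).
Proof.
move=> sf; elim: n => [|n IH].
  by under eq_fun do rewrite expr0; exact: smooth_cst.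
by under eq_fun do rewrite exprS; exact: smoothM sf IH.
Qed.

Lemma smooth_derive_within t f : smooth_within A f -> A t ->
  is_derive_within A t f (derive_within A f t).
Proof. by move=> sf At; apply: derivable_withinP => //; exact: (sf 0%N). Qed.

Lemma derive_withinD t f g : smooth_within A f -> smooth_within A g -> A t ->
  derive_within A (fun s => f s + g s) t =
  derive_within A f t + derive_within A g t.
Proof.
move=> sf sg At; have := is_derive_withinD pA At
  (smooth_derive_within sf At) (smooth_derive_within sg At).
by case/(is_derive_withinP pA).
Qed.

Lemma derive_withinM t f g : smooth_within A f -> smooth_within A g -> A t ->
  derive_within A (fun s => f s * g s) t =
  derive_within A f t * g t + f t * derive_within A g t.
Proof.
move=> sf sg At; have := is_derive_withinM pA At
  (smooth_derive_within sf At) (smooth_derive_within sg At).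
by case/(is_derive_withinP pA).
Qed.

Lemma derive_within_cst t (c : R) : A t -> derive_within A (fun=> c) t = 0.
Proof.
by move=> At; have := is_derive_within_cst pA c At; case/(is_derive_withinP pA).
Qed.

Lemma derive_within_eq t f g : (forall s, A s -> f s = g s) -> A t ->
  derive_within A f t = derive_within A g t.
Proof. exact: derive_within_local (rel_open_refl A). Qed.

Lemma derive_withinZ t (c : R) f : smooth_within A f -> A t ->
  derive_within A (fun s => c * f s) t = c * derive_within A f t.
Proof.
move=> sf At; rewrite (derive_withinM (@smooth_cst c))//.
by rewrite derive_within_cst// mul0r add0r.
Qed.

Lemma derive_within_sum t (T : Type) (r : seq T) (P : pred T)
    (F : T -> R -> R) : A t ->
  (forall i, P i -> smooth_within A (F i)) ->
  derive_within A (fun s => \sum_(i <- r | P i) F i s) t =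
  \sum_(i <- r | P i) derive_within A (F i) t.
Proof.
move=> At sF; elim: r => [|i r IH].
  under eq_fun do rewrite big_nil.
  by rewrite big_nil derive_within_cst.
under eq_fun do rewrite big_cons; rewrite big_cons.
case: (boolP (P i)) => [Pi|_]; last exact: IH.
by rewrite (derive_withinD (sF i Pi) (smooth_sum (r := r) sF) At) IH.
Qed.

Lemma smooth_cvg t f : smooth_within A f -> A t ->
  f s @[s --> within A t^'] --> f t.
Proof.
by move=> sf At; exact: (is_derive_within_cvg pA At (smooth_derive_within sf At)).
Qed.

Lemma smooth_derive_n n f : smooth_within A f ->
  smooth_within A (derive_within_n A n f).
Proof. by move=> sf; elim: n => [//|n IH]; exact: smooth_within_derive. Qed.

End Smoothness.

Arguments smooth_cst {R A} pA c.
Arguments smooth_id {R A} pA.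

(** * Mean value theorem and Taylor asymptotics *)

Section MeanValue.
Context {R : realType}.
Variable A : set R.
Hypothesis pA : proper_interval A.
Implicit Types (t : R) (f g : R -> R).

Lemma sub_within_dnbhs (F : set_system R) (FF : Filter F) t : F --> t -> F A ->
  F (fun s => s != t) -> within A t^' `<=` F.
Proof.
move=> Ft FA Fneq P; rewrite /within /= /dnbhs /within /= => /Ft.
move: Fneq; apply: filterS3 FA => s As st; exact.
Qed.

(** At a point strictly between a and b, the derivative along A is the usual
    one, and at a and b only continuity is needed. *)
Lemma mean_value f a b : (forall t, A t -> derivable_within A f t) ->
  A a -> A b -> a < b ->
  exists c, [/\ A c, a < c < b & f b - f a = derive_within A f c * (b - a)].
Proof.
move=> df Aa Ab ab.
have Aab c : a <= c <= b -> A c by exact: (pA.1 a b).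
have fc t : A t -> f s @[s --> within A t^'] --> f t.
  by move=> At; apply: (is_derive_within_cvg pA At);
    apply: derivable_withinP => //; exact: df.
have [||c + Ec] := MVT (f := f) (df := derive_within A f) ab.
- move=> x; rewrite in_itv /= => /andP[ax xb].
  have Ax : A x by apply: Aab; rewrite !ltW.
  have fl := derivable_withinP pA Ax (df x Ax).
  have : h^-1 *: (f (h *: 1 + x) - f x) @[h --> 0^'] --> derive_within A f x.
    have hx : h + x @[h --> 0^'] --> x.
      rewrite -[X in _ --> X]add0r; apply: cvgD; last exact: cvg_cst.
      exact: nbhs_dnbhs.
    have sub : within A x^' `<=` (h + x @[h --> 0^']).
      apply: sub_within_dnbhs => //.
      - have : \forall h \near 0^', a < h + x by exact: (cvgr_gt _ hx).
        have : \forall h \near 0^', h + x < b by exact: (cvgr_lt _ hx).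
        by apply: filterS2 => h hb ah; apply: Aab; rewrite !ltW.
      - have : \forall h \near 0^', h != 0 :> R by exact: nbhs_dnbhs_neq.
        by apply: filterS => h h0 /=; rewrite -subr_eq0 addrK.
    move=> P /fl /sub; rewrite /fmap /=; apply: filterS => h /=.
    by rewrite addrK [h *: 1]mulr1.
  by move=> xl; split; [apply/cvg_ex; exists (derive_within A f x)|exact: cvg_lim].
- apply/(continuous_within_itvP _ ab); split.
  + move=> x; rewrite in_itv /= => /andP[ax xb].
    have Ax : A x by apply: Aab; rewrite !ltW.
    apply/continuous_withinNx.
    move=> P /(fc _ Ax); apply: sub_within_dnbhs.
    * exact: nbhs_dnbhs.
    * apply: nbhs_dnbhs; near=> s; apply: Aab; apply/andP; split; apply: ltW.
        near: s; exact: lt_nbhsr.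
      near: s; exact: lt_nbhsl.
    * by rewrite /dnbhs; exact: withinT.
  + move=> P /(fc _ Aa); apply: sub_within_dnbhs.
    * exact: cvg_within.
    * near=> s; apply: Aab; apply/andP; split => //.
      near: s; exact: nbhs_right_le.
    * near=> s; rewrite gt_eqF//.
  + move=> P /(fc _ Ab); apply: sub_within_dnbhs.
    * exact: cvg_within.
    * near=> s; apply: Aab; apply/andP; split => //.
      near: s; exact: nbhs_left_ge.
    * near=> s; rewrite lt_eqF//.
rewrite in_itv /= => /andP[ac cb]; exists c; split => //; last by rewrite ac.
by apply: Aab; rewrite !ltW.
Unshelve. all: by end_near. Qed.

Lemma derive_within0_cst f : smooth_within A f ->
  (forall t, A t -> derive_within A f t = 0) ->
  forall a b, A a -> A b -> f a = f b.
Proof.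
move=> sf df0.
have H a b : A a -> A b -> a < b -> f a = f b.
  move=> Aa Ab ab; have [|c [Ac _]] := mean_value (f := f) _ Aa Ab ab.
    by move=> t; exact: (sf 0%N).
  by rewrite df0// mul0r => /eqP; rewrite subr_eq0 => /eqP.
move=> a b Aa Ab; have [ab|ba|->//] := ltgtP a b; first exact: H.
by apply/esym/H.
Qed.

Lemma is_derive_within_subX t (n : nat) u : A u ->
  is_derive_within A u (fun s => (s - t) ^+ n.+1) (n.+1%:R * (u - t) ^+ n).
Proof.
move=> Au.
have d1 : is_derive_within A u (fun s => s - t) 1.
  have := is_derive_withinD pA Au (is_derive_within_id pA Au)
    (is_derive_within_cst pA (- t) Au).
  by rewrite addr0.
elim: n => [|n IH]; first by rewrite expr0 mulr1; exact: d1.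
have := is_derive_withinM pA Au d1 IH.
rewrite mul1r mulrCA -exprS -[X in X + _]mul1r -mulrDl addrC natr1.
by apply: is_derive_within_eq => // s _; rewrite -exprS.
Qed.

(** The mean value theorem applied to g s - l (s - t)^(n+1) / (n+1), whose
    derivative at a point c between t and s is at most e |c - t|^n, hence at
    most e |s - t|^n. *)
Lemma cvg_integrate t g (l : R) n : A t ->
  (forall s, A s -> derivable_within A g s) -> g t = 0 ->
  derive_within A g s / (s - t) ^+ n @[s --> within A t^'] --> l ->
  g s / (s - t) ^+ n.+1 @[s --> within A t^'] --> l / n.+1%:R.
Proof.
move=> At dg gt0 gl; have FF := within_dnbhs_proper pA At.
apply/cvgrPdist_le => e e0.
move/cvgrPdist_le : gl => /(_ _ e0).
rewrite {1}/prop_near1 /within /= /dnbhs /within /= => /nbhs_ballP[d /= d0 Hd].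
pose phi s := g s + (- (l / n.+1%:R)) * (s - t) ^+ n.+1.
have dphi u : A u -> is_derive_within A u phi (derive_within A g u +
    (- (l / n.+1%:R)) * (n.+1%:R * (u - t) ^+ n)).
  move=> Au; apply: (is_derive_withinD pA Au).
    by apply: derivable_withinP => //; exact: dg.
  have := is_derive_withinM pA Au
    (is_derive_within_cst pA (- (l / n.+1%:R)) Au) (@is_derive_within_subX t n u Au).
  by rewrite mul0r add0r.
have dphi1 u : A u -> derivable_within A phi u.
  by move=> Au; have /(is_derive_withinP pA)[] := dphi _ Au.
have phit : phi t = 0 by rewrite /phi gt0 subrr expr0n /= mulr0 addr0.
have est c : A c -> c != t -> ball t d c ->
    `|derive_within A phi c| <= e * `|c - t| ^+ n.
  move=> Ac ct bc; have /(is_derive_withinP pA)-/(_ Ac)[_ ->] := dphi _ Ac.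
  have ct0 : (c - t) ^+ n != 0 by rewrite expf_neq0// subr_eq0.
  have := Hd c bc ct Ac; rewrite -(ler_pM2r (x := `|c - t| ^+ n)); last first.
    by rewrite -normrX normr_gt0.
  rewrite -{1}normrX -normrM mulrBl divfK// distrC => /(le_trans _); apply.
  rewrite le_eqVlt; apply/orP; left; apply/eqP; congr `|_|.
  by rewrite mulNr mulrA divfK// pnatr_eq0.
rewrite {1}/prop_near1 /within /= /dnbhs /within /=; apply/nbhs_ballP.
exists d => //= s bs st As.
have st0 : (s - t) ^+ n.+1 != 0 by rewrite expf_neq0// subr_eq0.
have -> : l / n.+1%:R - g s / (s - t) ^+ n.+1 = - (phi s / (s - t) ^+ n.+1).
  by rewrite /phi; field; rewrite st0 /= nat1r pnatr_eq0.
rewrite normrN normrM normfV ler_pdivrMr ?normr_gt0//.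
have {}phit : phi s = phi s - phi t by rewrite phit subr0.
have [ts|ts] : t < s \/ s < t by move: st; rewrite neq_lt => /orP[]; [right|left].
- have [c [Ac /andP[tc cs] E]] := mean_value dphi1 At As ts.
  rewrite phit E normrM normrX exprSr mulrA ler_wpM2r//.
  have bc : ball t d c.
    move: bs; rewrite /ball /= !ltr_norml => /andP[? ?]; apply/andP; split; lra.
  apply: (le_trans (est c Ac _ bc)); first by rewrite gt_eqF.
  rewrite ler_wpM2l ?(ltW e0)// lerXn2r ?nnegrE//.
  by rewrite !gtr0_norm ?subr_gt0//; lra.
- have [c [Ac /andP[sc ct] E]] := mean_value dphi1 As At ts.
  rewrite phit -normrN opprB E normrM normrX exprSr mulrA.
  rewrite (distrC t s) ler_wpM2r//.
  have bc : ball t d c.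
    move: bs; rewrite /ball /= !ltr_norml => /andP[? ?]; apply/andP; split; lra.
  apply: (le_trans (est c Ac _ bc)); first by rewrite lt_eqF.
  rewrite ler_wpM2l ?(ltW e0)// lerXn2r ?nnegrE//.
  by rewrite !ltr0_norm ?subr_lt0//; lra.
Qed.

(** Integrate n times the limit of the n-th derivative at t. *)
Lemma taylor_cvg t f n : A t -> smooth_within A f ->
  (forall j, (j < n)%N -> derive_within_n A j f t = 0) ->
  f s / (s - t) ^+ n @[s --> within A t^'] --> derive_within_n A n f t / n`!%:R.
Proof.
elim: n f => [|n IH] f At sf f0.
  rewrite fact0 divr1; under eq_fun do rewrite expr0 divr1.
  exact: smooth_cvg.
rewrite factS natrM invfM mulrA mulrAC.
have sf' := smooth_within_derive sf.
have nE j : derive_within_n A j (derive_within A f) = derive_within_n A j.+1 f.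
  by rewrite /derive_within_n iterSr.
have := IH _ At sf'; rewrite nE => IHf.
apply: (cvg_integrate At (sf 0%N) (f0 0%N isT)); apply: IHf => j jn.
by rewrite nE; apply: f0.
Qed.

End MeanValue.

(** * A Hilbert matrix, and limits of determinants *)

Section HilbertMatrix.
Context {R : realType}.

Lemma poly_eq0_on01 (q : {poly R}) : (forall x, 0 <= x <= 1 -> q.[x] = 0) ->
  q = 0.
Proof.
move=> q0; apply/eqP; apply: contraT => qn0.
pose rs := [seq (k.+1)%:R^-1 : R | k <- iota 0 (size q)].
have := @max_poly_roots _ q rs qn0.
rewrite size_map size_iota ltnn; apply; last first.
  rewrite map_inj_uniq ?iota_uniq// => i j /invr_inj/eqP.
  by rewrite eqr_nat eqSS => /eqP.
apply/allP => _ /mapP[k _ ->]; apply/rootP/q0.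
by rewrite invr_ge0 ler0n invf_le1 ?ltr0n// ler1n.
Qed.

Lemma horner_nondecreasing (q : {poly R}) :
  (forall x, 0 <= x <= 1 -> 0 <= q^`().[x]) ->
  forall x y, 0 <= x -> x <= y -> y <= 1 -> q.[x] <= q.[y].
Proof.
move=> q'0 x y x0 xy y1.
have [c cxy E] := MVT_segment (f := horner q) (df := horner q^`()) xy
  (fun z _ => is_derive_poly q z)
  (continuous_subspaceT (@continuous_horner R q)).
rewrite -subr_ge0 E mulr_ge0 ?subr_ge0//.
move: cxy; rewrite in_itv /= => /andP[xc cy].
by apply: q'0; rewrite (le_trans x0 xc) (le_trans cy y1).
Qed.

(** The Gram matrix of the functions x^i / i! for the scalar product of
    L^2([0, 1]), that is, the Hilbert matrix with rows and columns divided by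
    factorials. *)
Definition hilbert_mx m : 'M[R]_m :=
  \matrix_(i, j) (i`!%:R^-1 * j`!%:R^-1 * (i + j).+1%:R^-1).

(** A null vector v gives a polynomial p whose square has integral 0 over
    [0, 1]: its primitive q is nondecreasing and takes the value 0 at both
    ends, hence q = 0 and p = 0. *)
Lemma det_hilbert_mx m : \det (hilbert_mx m) != 0.
Proof.
apply/negP => /det0P[v vn0 vH].
pose a (i : 'I_m) : R := v 0 i / i`!%:R.
pose p : {poly R} := \sum_(i < m) a i *: 'X^i.
pose q : {poly R} :=
  \sum_(i < m) \sum_(j < m) (a i * a j / (i + j).+1%:R) *: 'X ^+ (i + j).+1.
have q'E : q^`() = p ^+ 2.
  rewrite /q expr2 {1}/p big_distrl raddf_sum; apply: eq_bigr => i _ /=.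
  rewrite /p big_distrr raddf_sum; apply: eq_bigr => j _ /=.
  rewrite derivZ derivXn /= -[X in _ *: X]scaler_nat scalerA divfK ?pnatr_eq0//.
  by rewrite exprD -[RHS]scalerAl -[X in _ = _ *: X]scalerAr [RHS]scalerA.
have q0 : q.[0] = 0.
  rewrite /q horner_sum big1 // => i _; rewrite horner_sum big1 // => j _.
  by rewrite hornerZ hornerXn expr0n /= mulr0.
have q1 : q.[1] = 0.
  have vHv : (v *m hilbert_mx m *m v^T) 0 0 =
      \sum_i \sum_j v 0 i * hilbert_mx m i j * v 0 j.
    rewrite mxE exchange_big /=; apply: eq_bigr => j _.
    by rewrite [(v *m _) _ _]mxE [v^T _ _]mxE big_distrl.
  have <- : (v *m hilbert_mx m *m v^T) 0 0 = 0 by rewrite vH mul0mx mxE.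
  rewrite vHv /q horner_sum; apply: eq_bigr => i _; rewrite horner_sum.
  apply: eq_bigr => j _.
  by rewrite hornerZ hornerXn expr1n mulr1 mxE /a; ring.
have qz : q = 0.
  have mono := horner_nondecreasing (q := q).
  have {}mono := mono (fun x _ => eq_ind_r (fun r => 0 <= r.[x])
    (eq_ind_r (fun y => 0 <= y) (sqr_ge0 p.[x]) (horner_exp p x 2)) q'E).
  apply: poly_eq0_on01 => x /andP[x0 x1]; apply/eqP; rewrite eq_le.
  by apply/andP; split; [rewrite -q1|rewrite -q0]; apply: mono.
move: q'E; rewrite qz linear0 => /esym/eqP; rewrite sqrf_eq0 => /eqP pz.
move/negP: vn0; apply; apply/eqP/rowP => k; rewrite mxE.
have : p`_k = 0 by rewrite pz coef0.
rewrite /p coef_sum (bigD1 k) //= big1 ?addr0; last first.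
  move=> i ik; rewrite coefZ coefXn (_ : (k == i :> nat) = false) ?mulr0//.
  by apply/negbTE; rewrite eq_sym.
rewrite coefZ coefXn eqxx mulr1 => /eqP.
by rewrite /a mulf_eq0 invr_eq0 pnatr_eq0 (gtn_eqF (fact_gt0 k)) orbF => /eqP.
Qed.

End HilbertMatrix.

Section DetLimits.
Context {R : realType}.

Lemma cvg_det (T : Type) (F : set_system T) (FF : Filter F) n
    (M : T -> 'M[R]_n) (N : 'M[R]_n) :
  (forall i j, M x i j @[x --> F] --> N i j) ->
  \det (M x) @[x --> F] --> \det N.
Proof.
move=> MN; rewrite /determinant.
apply: cvg_big => [|s _]; first exact: add_continuous.
apply: cvgM; first exact: cvg_cst.
by apply: cvg_big => [|i _]; [exact: mul_continuous|exact: MN].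
Qed.

Lemma det_scale n (a b : 'I_n -> R) (M : 'M[R]_n) :
  \det (\matrix_(i, j) (a i * M i j * b j)) =
  (\prod_i a i) * \det M * (\prod_j b j).
Proof.
have -> : \matrix_(i, j) (a i * M i j * b j) =
    diag_mx (\row_i a i) *m M *m diag_mx (\row_j b j).
  by apply/matrixP => i j; rewrite mul_mx_diag mul_diag_mx !mxE.
rewrite !det_mulmx !det_diag.
by congr (_ * _ * _); apply: eq_bigr => i _; rewrite mxE.
Qed.

Lemma prod_expr_square (x : R) n :
  (\prod_(i < n) x ^+ i.+1) * (\prod_(j < n) x ^+ j) = x ^+ (n ^ 2).
Proof.
elim: n => [|n IH]; first by rewrite !big_ord0 mulr1.
rewrite !big_ord_recr /= mulrACA IH -!exprD; congr (_ ^+ _).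
by rewrite -mulnn -[in RHS]mulnn mulnS mulSn; ring.
Qed.

End DetLimits.

(** * Order of vanishing of the determinant of a primitive *)

Section WeightAsymptotics.
Context {R : realType}.
Variable A : set R.
Hypothesis pA : proper_interval A.

Definition wronskian m (v : 'I_m -> R -> R) (t : R) : 'M[R]_m :=
  \matrix_(i, j) derive_within_n A j (v i) t.

Lemma derive_within_n_sum (T : finType) (c : T -> R) (f : T -> R -> R) n t :
  (forall i, smooth_within A (f i)) -> A t ->
  derive_within_n A n (fun s => \sum_i c i * f i s) t =
  \sum_i c i * derive_within_n A n (f i) t.
Proof.
move=> sf; elim: n t => [//|n IH] t At /=.
have sDf i : smooth_within A (derive_within_n A n (f i)).
  exact: smooth_derive_n.
rewrite (derive_within_eq IH At) (derive_within_sum pA)//.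
  by apply: eq_bigr => i _; rewrite (derive_withinZ pA _ (sDf i) At).
by move=> i _; exact: (smoothZ pA) (sDf i).
Qed.

(** In a basis adapted to the flag spanned by the derivatives of v at t, the
    component i of v vanishes at t to order at least i; the difference
    S s - S t, equal to sg times the integral of v v^T, is then a multiple of the Hilbert-like
    matrix up to powers of s - t and to higher order terms. *)
Lemma det_primitive_asymptotics m (S : R -> 'M[R]_m) (v : 'I_m -> R -> R)
    (sg t : R) : A t ->
  (forall i j, smooth_within A (fun s => S s i j)) ->
  (forall i, smooth_within A (v i)) ->
  (forall s i j, A s ->
    derive_within A (fun u => S u i j) s = sg * v i s * v j s) ->
  \det (S s - S t) / (s - t) ^+ (m ^ 2) @[s --> within A t^'] -->
    sg ^+ m * \det (wronskian v t) ^+ 2 * \det (@hilbert_mx R m).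
Proof.
case: m S v => [|n] S v At sS sv dS; have FF := within_dnbhs_proper pA At.
  rewrite !det_mx00 expr0 expr1n !mulr1.
  under eq_fun do rewrite det_mx00 expr0 divr1.
  exact: cvg_cst.
set V := wronskian v t; set m := n.+1 in S v sS sv dS V *.
(* Change of basis making the Wronskian matrix upper triangular; it exists
   even when this matrix is singular, by the LUP decomposition. *)
have [Q [Q0 QV]] : exists Q : 'M[R]_m,
    \det Q != 0 /\ forall i j : 'I_m, (j < i)%N -> (Q *m V) i j = 0.
  have := cormen_lup_correct V; have := cormen_lup_detL V.
  have := @cormen_lup_upper _ _ V; have := cormen_lup_perm V.
  case: (cormen_lup V) => -[P L] U /= /is_perm_mxP[s ->] Uup detL PV.
  have Lu : L \in unitmx by rewrite unitmxE detL unitr1.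
  exists (invmx L *m perm_mx s); split.
    by rewrite det_mulmx det_inv detL invr1 mul1r det_perm signr_eq0.
  move=> i j ji; rewrite -mulmxA [perm_mx s *m V]PV.
  by rewrite [(L * U)%R](erefl : _ = L *m U) mulKmx// Uup.
pose w i s := \sum_k Q i k * v k s.
have sw i : smooth_within A (w i).
  apply: (smooth_sum pA) => k _; exact: (smoothZ pA) (sv k).
have Dw i (j : 'I_m) : derive_within_n A j (w i) t = (Q *m V) i j.
  rewrite /w (derive_within_n_sum (Q i) j sv At) mxE.
  by apply: eq_bigr => k _; rewrite mxE.
pose d i := (Q *m V) i i.
have w_cvg (i : 'I_m) :
    w i s / (s - t) ^+ i @[s --> within A t^'] --> d i / i`!%:R.
  rewrite /d -Dw; apply: (taylor_cvg pA) => // j ji.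
  by rewrite (Dw i (Ordinal (ltn_trans ji (ltn_ord i)))) QV.
(* The entries of Q (S s - S t) Q^T. *)
pose b i j s := \sum_k \sum_l (Q i k * Q j l) * (S s k l - S t k l).
have sST k l : smooth_within A (fun s => S s k l - S t k l).
  exact: smoothB (sS k l) (smooth_cst pA _).
have sb1 i j k : smooth_within A
    (fun s => \sum_l (Q i k * Q j l) * (S s k l - S t k l)).
  by apply: (smooth_sum pA) => l _; exact: (smoothZ pA) (sST k l).
have sb i j : smooth_within A (b i j).
  by apply: (smooth_sum pA) => k _; exact: sb1.
have Db i j s : A s -> derive_within A (b i j) s = sg * w i s * w j s.
  move=> As; rewrite /b (derive_within_sum pA)//.
  rewrite /w -mulrA big_distrl big_distrr /=; apply: eq_bigr => k _.
  rewrite (derive_within_sum pA)//; last first.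
    by move=> l _; exact: (smoothZ pA) (sST k l).
  rewrite big_distrr big_distrr /=; apply: eq_bigr => l _.
  rewrite (derive_withinZ pA _ (sST k l) As).
  rewrite (derive_withinD pA (sS k l) (smooth_cst pA _) As).
  by rewrite derive_within_cst// addr0 dS//; ring.
have b_cvg (i j : 'I_m) : b i j s / (s - t) ^+ (i + j).+1
    @[s --> within A t^'] --> sg * d i * @hilbert_mx R m i j * d j.
  have bt : b i j t = 0.
    by rewrite /b big1// => k _; rewrite big1// => l _; rewrite subrr mulr0.
  have cc : (fun=> sg) @ within A t^' --> sg by exact: cvg_cst.
  have db_cvg : derive_within A (b i j) s / (s - t) ^+ (i + j)
      @[s --> within A t^'] --> sg * (d i / i`!%:R * (d j / j`!%:R)).
    apply: cvg_near_eq (cvgM cc (cvgM (w_cvg i) (w_cvg j))).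
    apply: filterS (near_within_neq A t) => s [As _].
    change (sg * (w i s / (s - t) ^+ i * (w j s / (s - t) ^+ j)) =
      derive_within A (b i j) s / (s - t) ^+ (i + j)).
    by rewrite Db// exprD invfM; ring.
  have -> : sg * d i * @hilbert_mx R m i j * d j =
      sg * (d i / i`!%:R * (d j / j`!%:R)) / (i + j).+1%:R.
    by rewrite mxE; ring.
  refine (cvg_integrate pA At (fun s => sb i j 0%N s) bt db_cvg).
(* Dividing row i by (s - t)^(i+1) and column j by (s - t)^j divides the
   determinant by (s - t)^(m^2). *)
pose M s := \matrix_(i, j) (b i j s / (s - t) ^+ (i + j).+1).
pose N := \matrix_(i, j) (sg * d i * @hilbert_mx R m i j * d j).
have {b_cvg} M_cvg : \det (M s) @[s --> within A t^'] --> \det N.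
  apply: cvg_det => i j; rewrite [X in _ --> X]mxE.
  by under eq_fun do rewrite mxE; exact: b_cvg.
have prod_d : \prod_i d i = \det Q * \det V.
  rewrite -det_mulmx -det_tr det_trig.
    by apply: eq_bigr => i _; rewrite mxE.
  by apply/is_trig_mxP => i j ij; rewrite mxE QV.
have detN : \det N = \det Q ^+ 2 *
    (sg ^+ m * \det V ^+ 2 * \det (@hilbert_mx R m)).
  rewrite det_scale big_split /= prodr_const card_ord prod_d; ring.
have detM s : s != t -> \det (M s) =
    \det Q ^+ 2 * (\det (S s - S t) / (s - t) ^+ (m ^ 2)).
  move=> st; have st0 : s - t != 0 by rewrite subr_eq0.
  have -> : M s = \matrix_(i, j) (((s - t) ^+ i.+1)^-1 *
      (Q *m (S s - S t) *m Q^T) i j * ((s - t) ^+ j)^-1).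
    apply/matrixP => i j; rewrite !mxE -addSn exprD invfM mulrA [X in X / _]mulrC.
    congr (_ * _ * _); rewrite [LHS]exchange_big; apply: eq_bigr => l _ /=.
    rewrite !mxE big_distrl; apply: eq_bigr => k _ /=.
    by rewrite !mxE; ring.
  rewrite det_scale !det_mulmx det_tr -prod_expr_square invfM.
  by rewrite !prodfV; ring.
have cc : (fun=> (\det Q ^+ 2)^-1) @ within A t^' --> (\det Q ^+ 2)^-1.
  exact: cvg_cst.
have Q2 : \det Q ^+ 2 != 0 by rewrite expf_neq0.
rewrite -[X in _ --> X](mulKf Q2) -detN.
apply: cvg_near_eq (cvgM cc M_cvg).
apply: filterS (near_within_neq A t) => s [_ st].
by rewrite -[RHS](mulKf Q2) -detM.
Qed.

End WeightAsymptotics.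

(** * Smooth matrices and vanishing Wronskians *)

Section SmoothMatrices.
Context {R : realType}.
Variable A : set R.
Hypothesis pA : proper_interval A.

Definition smooth_entries p q (M : R -> 'M[R]_(p, q)) :=
  forall i j, smooth_within A (fun t => M t i j).

Lemma smooth_mulmx p q r (M : R -> 'M[R]_(p, q)) (N : R -> 'M[R]_(q, r)) :
  smooth_entries M -> smooth_entries N -> smooth_entries (fun t => M t *m N t).
Proof.
move=> sM sN i j; under eq_fun do rewrite mxE.
by apply: (smooth_sum pA) => k _; exact: smoothM (sM i k) (sN k j).
Qed.

Lemma smooth_trmx p q (M : R -> 'M[R]_(p, q)) :
  smooth_entries M -> smooth_entries (fun t => (M t)^T).
Proof. by move=> sM i j; under eq_fun do rewrite mxE; exact: sM. Qed.

Lemma smooth_cst_mx p q (M : 'M[R]_(p, q)) : smooth_entries (fun=> M).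
Proof. by move=> i j; exact: smooth_cst. Qed.

Lemma smooth_det n (M : R -> 'M[R]_n) : smooth_entries M ->
  smooth_within A (fun t => \det (M t)).
Proof.
move=> sM; rewrite /determinant; apply: (smooth_sum pA) => s _.
by apply: (smoothZ pA); apply: (smooth_prod pA) => i _; exact: sM.
Qed.

Lemma smooth_invmx n (M : R -> 'M[R]_n) : smooth_entries M ->
  (forall t, A t -> \det (M t) != 0) -> smooth_entries (fun t => invmx (M t)).
Proof.
move=> sM M0 i j.
apply: (@smooth_eq _ _ (fun t => (\det (M t))^-1 * cofactor (M t) j i)).
  by move=> t At; rewrite /invmx unitmxE unitfE M0// !mxE.
have sdet := smooth_det sM.
apply: (smoothM pA); first exact: (smoothV pA M0 sdet).
rewrite /cofactor; apply: (smoothZ pA); apply: smooth_det => k l.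
by under eq_fun do rewrite !mxE; exact: sM.
Qed.

End SmoothMatrices.

Lemma smooth_entries_local {R : realType} (J I : set R) p q
    (M : R -> 'M[R]_(p, q)) :
  rel_open J I -> smooth_entries I M -> smooth_entries J M.
Proof. by move=> oJ sM i j; exact: smooth_within_local oJ _ (sM i j). Qed.

Section WronskianVanishing.
Context {R : realType}.
Variable A : set R.
Hypothesis pA : proper_interval A.

Lemma near_within_ball (t : R) (P : R -> Prop) : P t ->
  (\forall s \near within A t^', P s) ->
  exists2 e : R, 0 < e & forall s, A s -> ball t e s -> P s.
Proof.
move=> Pt; rewrite /prop_near1 /within /= /dnbhs /within /=.
move=> /nbhs_ballP[e /= e0 He]; exists e => // s As bs.
by have [->//|st] := eqVneq s t; exact: He.
Qed.

(** If the Wronskian determinant vanishes identically, choose a point where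
    the largest number r of derivatives v, v', ... is independent. Around it
    the span of the first r derivatives is stable under differentiation, hence
    constant, and it is a proper subspace. *)
Lemma wronskian0_dependent m (v : 'I_m -> R -> R) :
  (forall i, smooth_within A (v i)) ->
  (forall t, A t -> \det (wronskian A v t) = 0) ->
  exists (B : set R) (x : 'rV[R]_m), [/\ rel_open B A, proper_interval B,
    x != 0 & forall t, B t -> \sum_i x 0 i * v i t = 0].
Proof.
move=> sv W0.
pose J r t : 'M[R]_(m, r) := \matrix_(i, j) derive_within_n A j (v i) t.
have sJ r : smooth_entries A (J r).
  by move=> i j; under eq_fun do rewrite mxE; exact: smooth_derive_n.
pose P r := `[< exists2 t, A t & \rank (J r t) = r >].
have exP : exists r, P r.
  have [_ [a [_ [Aa _ _]]]] := pA.
  exists 0%N; apply/asboolP; exists a => //.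
  by apply/eqP; rewrite -leqn0 rank_leq_col.
have ubP r : P r -> (r <= m)%N.
  by move=> /asboolP[t _ <-]; exact: rank_leq_row.
have [r Pr maxr] := ex_maxnP exP ubP.
have rm : (r < m)%N.
  rewrite ltn_neqAle ubP// andbT; apply/eqP => rm; subst r.
  have /asboolP[t At Jt] := Pr; have := W0 t At.
  have : J m t \in unitmx by rewrite -row_free_unit /row_free Jt.
  by rewrite unitmxE unitfE => /eqP.
have /asboolP[t0 At0 Jt0] := Pr.
pose K := pinvmx (J r t0).
have KJ : K *m J r t0 = 1%:M by apply: mulVpmx; rewrite /row_full Jt0.
pose M t := K *m J r t.
have sM : smooth_entries A M by apply: smooth_mulmx => //; exact: smooth_cst_mx.
have sdM := smooth_det pA sM.
have Mt0 : \det (M t0) != 0 by rewrite /M KJ det1 oner_neq0.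
have FF := within_dnbhs_proper pA At0.
have [e e0 He] := near_within_ball Mt0 (cvgr_neq0 _ (smooth_cvg pA sdM At0) Mt0).
pose B := A `&` ball t0 e.
have oB : rel_open B A by apply: rel_open_setI; exact: ball_open.
have pB : proper_interval B by exact: proper_interval_ball.
have Bt0 : B t0 by split => //; exact: ballxx.
have MB t : B t -> \det (M t) != 0 by case=> At bt; exact: He.
have MuB t : B t -> M t \in unitmx by move=> Bt; rewrite unitmxE unitfE MB.
(* The columns of N t are the basis of the span of the first r derivatives
   that K maps to the standard basis; it is shown to be constant. *)
pose N t := J r t *m invmx (M t).
have sN : smooth_entries B N.
  apply: (smooth_mulmx pB); first exact: smooth_entries_local (sJ r).
  by apply: (smooth_invmx pB) => //; exact: smooth_entries_local sM.
have NM t : B t -> N t *m M t = J r t by move=> Bt; rewrite mulmxKV// MuB.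
(* N t K is a projection onto the span of the first r derivatives, which
   contains the next one because r is maximal. *)
have NKJ t : B t -> N t *m K *m J r.+1 t = J r.+1 t.
  move=> Bt.
  have rkJ : \rank (J r t) = r.
    apply/eqP; rewrite eqn_leq rank_leq_col /=.
    have := MuB t Bt; rewrite -row_free_unit /row_free => /eqP {1}<-.
    exact: mxrankM_maxr.
  have rkJ1 : (\rank (J r.+1 t) <= r)%N.
    rewrite leqNgt; apply/negP => rk.
    suff /maxr : P r.+1 by rewrite ltnn.
    apply/asboolP; exists t; first by case: Bt.
    by apply/eqP; rewrite eqn_leq rank_leq_col.
  have sub : ((J r t)^T <= (J r.+1 t)^T)%MS.
    apply/row_subP => j.
    have -> : row j (J r t)^T = row (widen_ord (leqnSn r) j) (J r.+1 t)^T.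
      by apply/rowP => i; rewrite !mxE.
    exact: row_sub.
  have : ((J r.+1 t)^T <= (J r t)^T)%MS.
    by rewrite -(mxrank_leqif_sup sub) !mxrank_tr rkJ eqn_leq rkJ1
      -{1}rkJ -(mxrank_tr (J r t)) -(mxrank_tr (J r.+1 t)) mxrankS.
  move=> /submxP[D]; rewrite -[X in X = _]trmxK => /(congr1 trmx).
  rewrite !trmxK trmx_mul trmxK => ->.
  by rewrite mulmxA -(mulmxA _ K) NM.
pose J' t : 'M[R]_(m, r) := \matrix_(i, j) derive_within_n A j.+1 (v i) t.
have NKJ' t : B t -> N t *m K *m J' t = J' t.
  move=> Bt; apply/matrixP => i j.
  have /matrixP/(_ i (lift ord0 j)) := NKJ t Bt.
  rewrite !mxE /= => <-; apply: eq_bigr => k _; by rewrite !mxE.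
have sJB := smooth_entries_local oB (sJ r).
have sMB := smooth_entries_local oB sM.
have DJ t i j : B t -> derive_within B (fun s => J r s i j) t = J' t i j.
  move=> Bt; rewrite mxE /=.
  by apply: (derive_within_local oB) => // s _; rewrite mxE.
have DM t i j : B t -> derive_within B (fun s => M s i j) t = (K *m J' t) i j.
  move=> Bt; under eq_fun do rewrite mxE.
  rewrite (derive_within_sum pB)//; last first.
    by move=> k _; apply: (smoothZ pB); exact: sJB.
  rewrite mxE; apply: eq_bigr => k _.
  by rewrite (derive_withinZ pB _ (sJB k j) Bt) DJ.
pose N' t : 'M[R]_(m, r) := \matrix_(i, j) derive_within B (fun s => N s i j) t.
have N'0 t : B t -> N' t = 0.
  move=> Bt; apply: (can_inj (mulmxK (MuB t Bt))); rewrite mul0mx.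
  apply: (addIr (N t *m (K *m J' t))); rewrite add0r [in RHS]mulmxA NKJ'//.
  apply/matrixP => i j; rewrite -DJ//.
  rewrite (derive_within_eq (g := fun s => \sum_k N s i k * M s k j) _ Bt).
    rewrite (derive_within_sum pB)//; last first.
      by move=> k _; exact: smoothM (sN i k) (sMB k j).
    rewrite !mxE -big_split; apply: eq_bigr => k _ /=.
    by rewrite (derive_withinM pB (sN i k) (sMB k j) Bt) DM// !mxE.
  by move=> s Bs; rewrite -NM// mxE.
have Ncst t : B t -> N t = N t0.
  move=> Bt; apply/matrixP => i j.
  apply: (derive_within0_cst pB (sN i j)) => // s Bs.
  by have /matrixP/(_ i j) := N'0 s Bs; rewrite !mxE.
have : ~~ row_free (N t0).
  by rewrite /row_free neq_ltn (leq_ltn_trans _ rm)// rank_leq_col.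
rewrite -kermx_eq0 => /rowV0Pn[x /sub_kermxP xN x0].
exists B, x; split => // t Bt.
have : x *m J r.+1 t = 0.
  by rewrite -NKJ// Ncst// -(mulmxA (N t0)) (mulmxA x) xN mul0mx.
move=> /rowP/(_ ord0); rewrite !mxE => E; rewrite -[RHS]E.
by apply: eq_bigr => i _; rewrite mxE.
Qed.

(** If k1 < k2, the quotient of order k1 is the one of order k2 times a power of
    s - t, and tends to 0. *)
Lemma cvg_quotient_uniq (h : R -> R) (t l1 l2 : R) k1 k2 : A t ->
  l1 != 0 -> l2 != 0 ->
  h s / (s - t) ^+ k1 @[s --> within A t^'] --> l1 ->
  h s / (s - t) ^+ k2 @[s --> within A t^'] --> l2 -> k1 = k2.
Proof.
move=> At; have FF := within_dnbhs_proper pA At.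
have H p q (a b : R) : a != 0 ->
    h s / (s - t) ^+ p @[s --> within A t^'] --> a ->
    h s / (s - t) ^+ q @[s --> within A t^'] --> b -> ~~ (p < q)%N.
  move=> a0 ha hb; apply/negP => pq; move/negP: a0; apply; apply/eqP.
  have sX : smooth_within A (fun s => (s - t) ^+ (q - p)).
    apply: (smoothX pA); exact: smoothB (smooth_id pA) (smooth_cst pA t).
  have := smooth_cvg pA sX At; rewrite subrr expr0n subn_eq0 leqNgt pq /= => x0.
  apply: (cvg_unique _ ha) => //.
  rewrite -(mulr0 b); apply: cvg_near_eq (cvgM hb x0).
  apply: filterS (near_within_neq A t) => s [_ st].
  have st0 : s - t != 0 by rewrite subr_eq0.
  change (h s / (s - t) ^+ q * (s - t) ^+ (q - p) = h s / (s - t) ^+ p).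
  rewrite -mulrA; congr (_ * _).
  rewrite -[in (s - t) ^- q](subnK (ltnW pq)) exprD invfM mulrAC mulVf ?mul1r//.
  by rewrite expf_neq0.
move=> l10 l20 h1 h2; apply/eqP; rewrite eqn_leq.
rewrite (leqNgt k1 k2) (leqNgt k2 k1).
by apply/andP; split; [exact: (H k2 k1 l2 l1)|exact: (H k1 k2 l1 l2)].
Qed.

(** The order of vanishing of det (S s - S t) at t is m^2 exactly at the points
    where the Wronskian determinant does not vanish.  If there were no such point,
    x (S s - S t) would be 0 for some constant vector x <> 0 and all s and t
    in some interval, so the determinant would vanish identically there. *)
Lemma wronskian_neq0 m (S : R -> 'M[R]_m) (v : 'I_m -> R -> R) (sg : R) k :
  sg != 0 ->
  (forall i j, smooth_within A (fun s => S s i j)) ->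
  (forall i, smooth_within A (v i)) ->
  (forall s i j, A s ->
    derive_within A (fun u => S u i j) s = sg * v i s * v j s) ->
  (forall t, A t -> exists2 l, l != 0 &
    \det (S s - S t) / (s - t) ^+ k @[s --> within A t^'] --> l) ->
  forall t, A t -> \det (wronskian A v t) != 0.
Proof.
move=> sg0 sS sv dS ord.
have lead t (At : A t) := det_primitive_asymptotics pA At sS sv dS.
have [t1 At1 Wt1] : exists2 t, A t & \det (wronskian A v t) != 0.
  apply: contrapT => noW.
  have [|B [x [oB pB x0 xv]]] := wronskian0_dependent sv.
    move=> t At; apply/eqP; apply: contraT => Wt; exfalso.
    by apply: noW; exists t.
  have [_ [t [_ [Bt _ _]]]] := pB.
  have At := oB.1 _ Bt; have FF := within_dnbhs_proper pA At.
  have [l l0 hl] := ord t At; move/negP: l0; apply; apply/eqP.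
  apply: (cvg_unique _ hl) => //.
  have c0 : (fun=> 0) @ within A t^' --> (0 : R) by exact: cvg_cst.
  apply: cvg_near_eq c0; rewrite -(within_dnbhs_rel_open oB Bt).
  apply: filterS (near_within_neq B t) => s [Bs _].
  suff -> : \det (S s - S t) = 0 by rewrite mul0r.
  apply/eqP/det0P; exists x => //; rewrite mulmxBr; apply/eqP.
  rewrite subr_eq0; apply/eqP/rowP => j; rewrite !mxE.
  have sSB i : smooth_within B (fun u => S u i j).
    exact: smooth_within_local oB _ (sS i j).
  have sxS i : smooth_within B (fun u => x 0 i * S u i j).
    by apply: (smoothZ pB); exact: sSB.
  apply: (derive_within0_cst pB (f := fun u => \sum_i x 0 i * S u i j)) => //.
    by apply: (smooth_sum pB) => i _; exact: sxS.
  move=> u Bu; rewrite (derive_within_sum pB)//.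
  have := xv u Bu => /(congr1 (fun y => y * (sg * v j u))).
  rewrite mul0r big_distrl => E; rewrite -[RHS]E; apply: eq_bigr => i _ /=.
  rewrite (derive_withinZ pB _ (sSB i) Bu).
  rewrite (derive_within_local oB (g := fun u => S u i j) _ Bu)// dS.
    by ring.
  exact: oB.1.
have k_eq : k = (m ^ 2)%N.
  have [l l0 hl] := ord t1 At1.
  refine (cvg_quotient_uniq At1 l0 _ hl (lead t1 At1)).
  by rewrite !mulf_neq0// ?expf_neq0// det_hilbert_mx.
move=> t At; apply/negP => /eqP Wt.
have FF := within_dnbhs_proper pA At.
have [l l0 hl] := ord t At; move/negP: l0; apply; apply/eqP.
have := lead t At; rewrite Wt expr0n mulr0 mul0r -k_eq => h0.
exact: (cvg_unique _ hl h0).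
Qed.

End WronskianVanishing.

(** * Skew forms and curves in a vector space *)

Section SkewForm.
Context {R : realType} {W : vectType R}.
Variable sigma : {skew_symmetric W}.
Implicit Types (u v w : W) (a : R).

Lemma skewC u v : sigma u v = - sigma v u.
Proof. by rewrite hermC expr1 mulN1r. Qed.

Lemma skewDl u v w : sigma (u + v) w = sigma u w + sigma v w.
Proof. exact: linearDl. Qed.

Lemma skewDr u v w : sigma w (u + v) = sigma w u + sigma w v.
Proof. exact: linearDr. Qed.

Lemma skewZl a u w : sigma (a *: u) w = a * sigma u w.
Proof. exact: linearZl_LR. Qed.

Lemma skewZr a u w : sigma w (a *: u) = a * sigma w u.
Proof. by rewrite skewC skewZl -mulrN -skewC. Qed.

Lemma skewNl u w : sigma (- u) w = - sigma u w.
Proof. exact: linearNl. Qed.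

Lemma skewNr u w : sigma w (- u) = - sigma w u.
Proof. exact: linearNr. Qed.

Lemma skew_suml (T : Type) (r : seq T) (P : pred T) (F : T -> W) w :
  sigma (\sum_(i <- r | P i) F i) w = \sum_(i <- r | P i) sigma (F i) w.
Proof. exact: linear_sumlz. Qed.

Lemma skew_sumr (T : Type) (r : seq T) (P : pred T) (F : T -> W) w :
  sigma w (\sum_(i <- r | P i) F i) = \sum_(i <- r | P i) sigma w (F i).
Proof. exact: linear_sumr. Qed.

Lemma skew_self u : sigma u u = 0.
Proof.
by apply/eqP; rewrite -[_ == 0](mulrn_eq0 _ 2) mulr2n {1}skewC addNr.
Qed.

End SkewForm.

Section CurveCalculus.
Context {R : realType} {W : vectType R}.
Implicit Types (A I J : set R) (c d : R -> W) (g : R -> R) (t : R).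

Let vb := vbasis {:W}.
Let co (i : 'I_(\dim {:W})) (w : W) : R := coord vb i w.

Let co_ext u v : (forall i, co i u = co i v) -> u = v.
Proof.
move=> uv; rewrite (coord_vbasis (memvf u)) (coord_vbasis (memvf v)).
by apply: eq_bigr => i _; congr (_ *: _); exact: uv.
Qed.

Let coD i u v : co i (u + v) = co i u + co i v.
Proof. exact: linearD. Qed.

Let coZ i a v : co i (a *: v) = a * co i v.
Proof. exact: linearZ. Qed.

Lemma smooth_curve_coord A c : proper_interval A -> smooth_curve A c <->
  forall i, smooth_within A (fun t => coord (vbasis {:W}) i (c t)).
Proof.
move=> pA; rewrite /smooth_curve (smooth_within_entries _ pA).
split=> [H i|H i j].
  by have := H 0 i; under eq_fun do rewrite mxE; exact.
by under eq_fun do rewrite mxE; exact: H.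
Qed.

Lemma coord_curve_derive A c t i : proper_interval A -> smooth_curve A c ->
  A t -> coord (vbasis {:W}) i (curve_derive A c t) =
    derive_within A (fun s => coord (vbasis {:W}) i (c s)) t.
Proof.
move=> pA sc At; rewrite /curve_derive passmx.coord_vecof ?vbasisP//.
rewrite (derive_within_entries _ _ pA At (sc 0%N t At)).
by under eq_fun do rewrite mxE.
Qed.

Lemma curve_derive_local J I c d t : rel_open J I ->
  (forall s, J s -> c s = d s) -> J t ->
  curve_derive J c t = curve_derive I d t.
Proof.
move=> oJ cd Jt; congr passmx.vecof.
by apply: (derive_within_local oJ) => // s Js; rewrite cd.
Qed.

Lemma smooth_curve_local J I c d : rel_open J I ->
  (forall s, J s -> c s = d s) -> smooth_curve I d -> smooth_curve J c.
Proof.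
by move=> oJ cd; apply: smooth_within_local => // s Js; rewrite cd.
Qed.

Lemma smooth_curve_glue I c :
  (forall t, I t -> exists J d, [/\ rel_open J I, J t, smooth_curve J d &
     forall s, J s -> c s = d s]) ->
  smooth_curve I c.
Proof.
move=> loc; apply: smooth_within_glue => t /loc[J [d [oJ Jt sd cd]]].
by exists J, (fun s => passmx.rVof vb (d s)); split => // s Js; rewrite cd.
Qed.

Variable A : set R.
Hypothesis pA : proper_interval A.

Let scoP c : smooth_curve A c <-> forall i, smooth_within A (fun t => co i (c t)).
Proof. exact: smooth_curve_coord. Qed.

Let codP c t i : smooth_curve A c -> A t ->
  co i (curve_derive A c t) = derive_within A (fun s => co i (c s)) t.
Proof. exact: coord_curve_derive. Qed.

Lemma smooth_curve_eq c d : (forall s, A s -> c s = d s) -> smooth_curve A d ->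
  smooth_curve A c.
Proof. exact: smooth_curve_local (rel_open_refl A). Qed.

Lemma curve_derive_eq c d t : (forall s, A s -> c s = d s) -> A t ->
  curve_derive A c t = curve_derive A d t.
Proof. exact: curve_derive_local (rel_open_refl A). Qed.

Lemma smooth_curve_derive c : smooth_curve A c ->
  smooth_curve A (curve_derive A c).
Proof.
move=> sc; apply/scoP => i.
apply: (smooth_eq (f := derive_within A (fun s => co i (c s)))).
  by move=> t At; rewrite codP.
by apply: smooth_within_derive; move/scoP : sc.
Qed.

Lemma smooth_curve_cst w : smooth_curve A (fun=> w : W).
Proof. by apply/scoP => i; exact: smooth_cst. Qed.

Lemma curve_derive_cst w t : A t -> curve_derive A (fun=> w : W) t = 0.
Proof.
move=> At; apply: co_ext => i; rewrite codP//; last exact: smooth_curve_cst.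
by rewrite derive_within_cst// /co linear0.
Qed.

Lemma smooth_curveD c d : smooth_curve A c -> smooth_curve A d ->
  smooth_curve A (fun t => c t + d t).
Proof.
move=> /scoP sc /scoP sd; apply/scoP => i.
by under eq_fun do rewrite coD; exact: smoothD (sc i) (sd i).
Qed.

Lemma curve_deriveD c d t : smooth_curve A c -> smooth_curve A d -> A t ->
  curve_derive A (fun t => c t + d t) t =
  curve_derive A c t + curve_derive A d t.
Proof.
move=> sc sd At; apply: co_ext => i.
rewrite [LHS](codP _ (smooth_curveD sc sd) At) coD.
rewrite (@codP c t i sc At) (@codP d t i sd At).
move/scoP : sc => /(_ i) sc; move/scoP : sd => /(_ i) sd.
by under eq_fun do rewrite coD; exact: derive_withinD sc sd At.
Qed.

Lemma smooth_curveZ g c : smooth_within A g -> smooth_curve A c ->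
  smooth_curve A (fun t => g t *: c t).
Proof.
move=> sg /scoP sc; apply/scoP => i.
by under eq_fun do rewrite coZ; exact: smoothM sg (sc i).
Qed.

Lemma curve_deriveZ g c t : smooth_within A g -> smooth_curve A c -> A t ->
  curve_derive A (fun t => g t *: c t) t =
  derive_within A g t *: c t + g t *: curve_derive A c t.
Proof.
move=> sg sc At; apply: co_ext => i.
rewrite [LHS](codP _ (smooth_curveZ sg sc) At) coD !coZ (@codP c t i sc At).
move/scoP : sc => /(_ i) sc.
by under eq_fun do rewrite coZ; exact: derive_withinM sg sc At.
Qed.

Lemma smooth_curve_sum (T : Type) (r : seq T) (F : T -> R -> W) :
  (forall i, smooth_curve A (F i)) ->
  smooth_curve A (fun s => \sum_(i <- r) F i s).
Proof.
move=> sF; elim: r => [|i r IH].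
  by under eq_fun do rewrite big_nil; exact: smooth_curve_cst.
by under eq_fun do rewrite big_cons; exact: smooth_curveD (sF i) IH.
Qed.

Lemma curve_derive_sum (T : Type) (r : seq T) (F : T -> R -> W) t : A t ->
  (forall i, smooth_curve A (F i)) ->
  curve_derive A (fun s => \sum_(i <- r) F i s) t =
  \sum_(i <- r) curve_derive A (F i) t.
Proof.
move=> At sF; elim: r => [|i r IH].
  under eq_fun do rewrite big_nil.
  by rewrite big_nil curve_derive_cst.
under eq_fun do rewrite big_cons; rewrite big_cons.
by rewrite (curve_deriveD (sF i) (smooth_curve_sum (r := r) sF) At) IH.
Qed.

Lemma smooth_curveZc a c : smooth_curve A c -> smooth_curve A (fun t => a *: c t).
Proof. exact: smooth_curveZ (smooth_cst pA a). Qed.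

Lemma curve_deriveZc a c t : smooth_curve A c -> A t ->
  curve_derive A (fun t => a *: c t) t = a *: curve_derive A c t.
Proof.
move=> sc At; rewrite (curve_deriveZ (smooth_cst pA a) sc At).
by rewrite derive_within_cst// scale0r add0r.
Qed.

Variable sigma : {skew_symmetric W}.

Let sigmaE u v : sigma u v =
  \sum_(i < \dim {:W}) \sum_(j < \dim {:W}) (sigma vb`_i vb`_j * co i u) * co j v.
Proof.
rewrite {1}(coord_vbasis (memvf u)) {1}(coord_vbasis (memvf v)) skew_suml.
apply: eq_bigr => i _; rewrite skew_sumr; apply: eq_bigr => j _.
by rewrite skewZl skewZr /co; ring.
Qed.

Let smooth_sigma_term c d (i j : 'I_(\dim {:W})) : smooth_curve A c -> smooth_curve A d ->
  smooth_within A (fun t => (sigma vb`_i vb`_j * co i (c t)) * co j (d t)).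
Proof.
move=> /scoP sc /scoP sd.
by apply: (smoothM pA); [apply: (smoothZ pA); exact: sc|exact: sd].
Qed.

Lemma smooth_skew c d : smooth_curve A c -> smooth_curve A d ->
  smooth_within A (fun t => sigma (c t) (d t)).
Proof.
move=> sc sd; under eq_fun do rewrite sigmaE.
apply: (smooth_sum pA) => i _; apply: (smooth_sum pA) => j _.
exact: smooth_sigma_term.
Qed.

(** Expand sigma in the coordinates of the reference basis of W. *)
Lemma derive_skew c d t : smooth_curve A c -> smooth_curve A d -> A t ->
  derive_within A (fun s => sigma (c s) (d s)) t =
  sigma (curve_derive A c t) (d t) + sigma (c t) (curve_derive A d t).
Proof.
move=> sc sd At; under eq_fun do rewrite sigmaE.
rewrite !sigmaE -big_split (derive_within_sum pA)//; last first.
  move=> i _; apply: (smooth_sum pA) => j _; exact: smooth_sigma_term.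
apply: eq_bigr => i _ /=; rewrite -big_split (derive_within_sum pA)//; last first.
  by move=> j _; exact: smooth_sigma_term.
apply: eq_bigr => j _ /=.
have sci := (scoP c).1 sc i; have sdj := (scoP d).1 sd j.
rewrite (derive_withinM pA (smoothZ pA sci) sdj At) (derive_withinZ pA _ sci At).
by rewrite !codP.
Qed.

End CurveCalculus.

(** * Generating curves: rigidity and gluing *)

Section IteratedDerivatives.
Context {R : realType} {W : vectType R}.
Variable sigma : {skew_symmetric W}.
Implicit Types (A I J : set R) (c d : R -> W) (t : R).

Definition curve_derive_n A n c : R -> W := iter n (curve_derive A) c.

Lemma smooth_curve_derive_n A n c : proper_interval A -> smooth_curve A c ->
  smooth_curve A (curve_derive_n A n c).
Proof. by move=> pA sc; elim: n => [//|n IH]; exact: smooth_curve_derive. Qed.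

Lemma curve_derive_n_local J I n c d t : rel_open J I ->
  (forall s, J s -> c s = d s) -> J t ->
  curve_derive_n J n c t = curve_derive_n I n d t.
Proof.
move=> oJ cd; elim: n t => [|n IH] t Jt /=; first exact: cd.
exact: curve_derive_local.
Qed.

Lemma curve_derive_nZ A n a c t : proper_interval A -> smooth_curve A c ->
  A t -> curve_derive_n A n (fun s => a *: c s) t = a *: curve_derive_n A n c t.
Proof.
move=> pA sc; elim: n t => [//|n IH] t At /=.
rewrite (curve_derive_eq (d := fun s => a *: curve_derive_n A n c s) IH At).
by rewrite (curve_deriveZc pA a (smooth_curve_derive_n (n := n) pA sc) At).
Qed.

(** Derivatives can be moved from one argument of a constant pairing to the
    other; all the identities between pairings below are obtained in this way. *)
Lemma skew_derive_cst A c d (k : R) t : proper_interval A ->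
  smooth_curve A c -> smooth_curve A d ->
  (forall s, A s -> sigma (c s) (d s) = k) -> A t ->
  sigma (c t) (curve_derive A d t) = - sigma (curve_derive A c t) (d t).
Proof.
move=> pA sc sd cdk At; apply/eqP; rewrite -addr_eq0 addrC.
rewrite -(derive_skew pA sigma sc sd At) (derive_within_eq (g := fun=> k))//.
by rewrite derive_within_cst.
Qed.

(** From f^2 = 1 follows f f' = 0, where f does not vanish. *)
Lemma smooth_sqr1_cst A (f : R -> R) : proper_interval A ->
  smooth_within A f -> (forall t, A t -> f t ^+ 2 = 1) ->
  exists2 a, a ^+ 2 = 1 & forall t, A t -> f t = a.
Proof.
move=> pA sf f1; have [_ [t0 [_ [At0 _ _]]]] := pA.
exists (f t0); first exact: f1.
move=> t At; apply: (derive_within0_cst pA sf) => // s As.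
have : derive_within A (fun u => f u * f u) s = 0.
  have E u : A u -> f u * f u = 1 by move=> Au; rewrite -expr2 f1.
  by rewrite (derive_within_eq E As) derive_within_cst.
rewrite (derive_withinM pA sf sf As) mulrC -mulr2n => /eqP.
rewrite mulrn_eq0 mulf_eq0 /= => /orP[/eqP fs|/eqP//].
by have := f1 s As; rewrite fs expr0n => /esym/eqP; rewrite oner_eq0.
Qed.

End IteratedDerivatives.

Section GeneratingCurves.
Context {R : realType} {W : vectType R} {m : nat}.
Variable sigma : {skew_symmetric W}.
Variables (I : set R) (Lam : R -> {vspace W}).
Hypothesis m_gt0 : (0 < m)%N.
Hypothesis dimW : \dim {:W} = (2 * m)%N.
Hypothesis nondeg : forall w, (forall v, sigma w v = 0) -> w = 0.
Hypothesis pI : proper_interval I.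
Hypothesis isoL : forall t, I t -> {in Lam t &, forall u v, sigma u v = 0}.
Implicit Types (A J : set R) (c d : R -> W) (t : R).

(** The first vector of a normal frame: its first m - 1 derivatives stay in
    the Lagrangian subspaces, and the next one leaves them in a normalized way. *)
Definition generating A c := [/\ smooth_curve A c,
  forall t, A t -> forall j, (j < m)%N -> curve_derive_n A j c t \in Lam t &
  forall t, A t ->
    sigma (curve_derive_n A m c t) (curve_derive_n A m.-1 c t) ^+ 2 = 1].

Lemma generating_local J A c d : rel_open J A ->
  (forall s, J s -> c s = d s) -> generating A d -> generating J c.
Proof.
move=> oJ cd [sd dL d1]; split.
- exact: smooth_curve_local oJ cd sd.
- move=> t Jt j jm; rewrite (curve_derive_n_local _ oJ cd Jt).
  by apply: dL => //; exact: oJ.1.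
- move=> t Jt; rewrite !(curve_derive_n_local _ oJ cd Jt).
  by apply: d1; exact: oJ.1.
Qed.

Lemma generating_glue A c :
  (forall t, A t -> exists J d, [/\ rel_open J A, J t, generating J d &
     forall s, J s -> c s = d s]) ->
  generating A c.
Proof.
move=> loc.
have E J d n t : rel_open J A -> (forall s, J s -> c s = d s) -> J t ->
    curve_derive_n A n c t = curve_derive_n J n d t.
  move=> oJ cd Jt; rewrite -(curve_derive_n_local n oJ (fun _ _ => erefl) Jt).
  exact: curve_derive_n_local (rel_open_refl J) cd Jt.
split.
- apply: smooth_curve_glue => t /loc[J [d [oJ Jt [sd _ _] cd]]].
  by exists J, d; split.
- move=> t /loc[J [d [oJ Jt [_ dL _] cd]]] j jm.
  by rewrite (E J d)//; exact: dL.
- move=> t /loc[J [d [oJ Jt [_ _ d1] cd]]].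
  by rewrite !(E J d)//; exact: d1.
Qed.

Lemma generatingZ A c a : proper_interval A -> a ^+ 2 = 1 -> generating A c ->
  generating A (fun t => a *: c t).
Proof.
move=> pA a1 [sc cL c1]; split.
- exact: (smooth_curveZc (a := a) pA sc).
- move=> t At j jm; rewrite (curve_derive_nZ j a pA sc At); apply: memvZ; exact: cL.
- move=> t At; rewrite !(curve_derive_nZ _ a pA sc At) skewZl skewZr mulrA -expr2 a1 mul1r.
  exact: c1.
Qed.

Section Pairings.
Variable A : set R.
Hypotheses (pA : proper_interval A) (AI : A `<=` I).

Let pair_step c d i j (k : R) t : smooth_curve A c -> smooth_curve A d ->
  (forall s, A s ->
     sigma (curve_derive_n A i c s) (curve_derive_n A j d s) = k) -> A t ->
  sigma (curve_derive_n A i c t) (curve_derive_n A j.+1 d t) =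
  - sigma (curve_derive_n A i.+1 c t) (curve_derive_n A j d t).
Proof.
move=> sc sd H At; exact: (skew_derive_cst pA (smooth_curve_derive_n (n := i) pA sc)
  (smooth_curve_derive_n (n := j) pA sd) H At).
Qed.

(* The derivatives of order less than m lie in isotropic subspaces; the other
   orders follow by moving derivatives to the other side. *)
Let pair0_half c d i k t : generating A c -> generating A d -> A t ->
  (i + k < m)%N ->
  sigma (curve_derive_n A i c t) (curve_derive_n A (m.-1 + k) d t) = 0.
Proof.
move=> [sc cL _] [sd dL _]; elim: k i t => [|k IH] i t At ikm.
  rewrite addn0; apply: (isoL (AI At)).
    by apply: cL => //; move: ikm; rewrite addn0.
  by apply: dL => //; rewrite prednK.
rewrite addnS (pair_step (k := 0) sc sd)//.
  by rewrite IH ?oppr0// addSnnS.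
by move=> s As; apply: IH => //; apply: leq_trans ikm; rewrite addnS.
Qed.

Lemma generating_pair0 c d i j t : generating A c -> generating A d -> A t ->
  (i + j < (2 * m).-1)%N ->
  sigma (curve_derive_n A i c t) (curve_derive_n A j d t) = 0.
Proof.
move=> gc gd At ij.
have [jm|mj] := ltnP j m; last first.
  have -> : j = (m.-1 + (j - m.-1))%N by lia.
  by apply: pair0_half => //; lia.
have [im|mi] := ltnP i m.
  by apply: (isoL (AI At)); [case: gc => _ + _|case: gd => _ + _]; exact.
rewrite skewC; have -> : i = (m.-1 + (i - m.-1))%N by lia.
by rewrite pair0_half ?oppr0//; lia.
Qed.

Lemma generating_pair1 c d i t : generating A c -> generating A d -> A t ->
  (i < 2 * m)%N ->
  sigma (curve_derive_n A i c t) (curve_derive_n A ((2 * m).-1 - i) d t) =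
  (-1) ^+ i * sigma (c t) (curve_derive_n A (2 * m).-1 d t).
Proof.
move=> gc gd At; elim: i => [|i IH] im; first by rewrite subn0 expr0 mul1r.
have [sc _ _] := gc; have [sd _ _] := gd.
have := @pair_step c d i ((2 * m).-1 - i.+1) 0 t sc sd.
rewrite -subSn; last by lia.
rewrite subSS IH; last by lia.
move=> /(_ _ At) H; rewrite exprS -mulrA mulN1r H ?opprK// => s As.
by apply: generating_pair0 => //; lia.
Qed.

Let beta_sqr c t : generating A c -> A t ->
  sigma (c t) (curve_derive_n A (2 * m).-1 c t) ^+ 2 = 1.
Proof.
move=> gc At; have [_ _ /(_ t At)] := gc.
have mm : (m < 2 * m)%N by lia.
have := generating_pair1 gc gc At mm.
have -> : ((2 * m).-1 - m = m.-1)%N by lia.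
by move=> ->; rewrite exprMn -exprM mulnC exprM sqrrN expr1n expr1n mul1r.
Qed.

(** The matrix of the pairings between c, c', ..., c^(2m-1) is triangular with
    respect to its second diagonal, where its entries are 1 or -1; so these
    vectors form a basis of W. *)
Lemma generating_nondeg c t w : generating A c -> A t ->
  (forall j, (j < 2 * m)%N -> sigma w (curve_derive_n A j c t) = 0) -> w = 0.
Proof.
move=> gc At w0.
have b0 : sigma (c t) (curve_derive_n A (2 * m).-1 c t) != 0.
  by apply/eqP => b0; have := beta_sqr gc At; rewrite b0 expr0n => /esym/eqP;
    rewrite oner_eq0.
pose X : (2 * m).-tuple W := [tuple curve_derive_n A i c t | i < 2 * m].
have Xi (i : 'I_(2 * m)) : X`_i = curve_derive_n A i c t.
  by rewrite -tnth_nth tnth_mktuple.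
have fX : free X.
  apply/freeP => k Xk.
  suff H p : forall i : 'I_(2 * m), ((2 * m).-1 - p <= i)%N -> k i = 0.
    by move=> i; apply: (H (2 * m).-1); rewrite subnn.
  elim: p => [|p IH] i pi.
    move/(congr1 (sigma (c t))) : Xk; rewrite skew_sumr (bigD1 i)//=.
    rewrite big1 ?addr0; last first.
      move=> j ji; rewrite skewZr Xi.
      rewrite (generating_pair0 (i := 0) gc gc At) ?mulr0//.
      by move: ji; rewrite -val_eqE /=; have := ltn_ord i; have := ltn_ord j; lia.
    rewrite skewZr Xi linear0r.
    have -> : i = (2 * m).-1 :> nat by have := ltn_ord i; lia.
    by move/eqP; rewrite mulf_eq0 (negPf b0) orbF => /eqP.
  have [le_i|lt_i] := leqP ((2 * m).-1 - p) i; first exact: IH.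
  move/(congr1 (sigma (curve_derive_n A ((2 * m).-1 - i) c t))) : Xk.
  rewrite skew_sumr (bigD1 i)//= big1 ?addr0; last first.
    move=> j ji; rewrite skewZr Xi.
    have [lt_ji|le_ij] := ltnP j i.
      rewrite (generating_pair0 gc gc At) ?mulr0//.
      by have := ltn_ord i; lia.
    rewrite IH ?mul0r//.
    by move: ji; rewrite -val_eqE /=; lia.
  rewrite skewZr Xi linear0r => /eqP; rewrite mulf_eq0 => /orP[/eqP//|].
  rewrite skewC (generating_pair1 gc gc At (ltn_ord i)) oppr_eq0 mulf_eq0.
  by rewrite signr_eq0 (negPf b0).
have bX : basis_of fullv X.
  by rewrite basisEfree fX subvf size_tuple dimW leqnn.
apply: nondeg => v; rewrite (coord_basis bX (memvf v)) skew_sumr big1// => i _.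
by rewrite skewZr Xi w0 ?mulr0.
Qed.

Lemma generating_neq0 c t : generating A c -> A t -> c t != 0.
Proof.
move=> gc At; apply/eqP => c0; have := beta_sqr gc At.
by rewrite c0 linear0l expr0n => /esym/eqP; rewrite oner_eq0.
Qed.

(** With a = sigma(d, c^(2m-1)) / sigma(c, c^(2m-1)), the vector d - a c is
    orthogonal to all the derivatives of c of order less than 2m, hence d = a c.
    Comparing sigma(d, d^(2m-1)) with sigma(c, c^(2m-1)) gives a^4 = 1. *)
Lemma generating_unique c d : generating A c -> generating A d ->
  exists2 a : R, a ^+ 2 = 1 & forall t, A t -> d t = a *: c t.
Proof.
move=> gc gd; have [sc _ _] := gc; have [sd _ _] := gd.
set n := (2 * m).-1.
(* The division is written as a product, since sigma(c, c^(2m-1)) is 1 or -1. *)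
pose a t := sigma (d t) (curve_derive_n A n c t) *
  sigma (c t) (curve_derive_n A n c t).
have sa : smooth_within A a.
  have sDc := smooth_curve_derive_n (n := n) pA sc.
  by apply: (smoothM pA); [exact: smooth_skew sd sDc|exact: smooth_skew sc sDc].
have dac t : A t -> d t = a t *: c t.
  move=> At; apply/eqP; rewrite -subr_eq0; apply/eqP.
  apply: (generating_nondeg gc At) => j jm.
  rewrite skewDl skewNl skewZl.
  have [jn|nj] := ltnP j n.
    by rewrite !(generating_pair0 (i := 0))// mulr0 subrr.
  have -> : j = n by rewrite /n in nj *; lia.
  by rewrite /a -mulrA -expr2 beta_sqr// mulr1 subrr.
have a1 t : A t -> a t ^+ 2 = 1.
  move=> At; have bc := beta_sqr gc At; have := beta_sqr gd At.
  have nm : (n < 2 * m)%N by rewrite /n; lia.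
  have cd : sigma (c t) (curve_derive_n A n d t) =
      - ((-1) ^+ n * (a t * sigma (c t) (curve_derive_n A n c t))).
    have := generating_pair1 gd gc At nm; rewrite -/n subnn /= => H.
    by rewrite skewC H {1}(dac t At) skewZl.
  rewrite -/n in bc *; rewrite {1}(dac t At) skewZl cd.
  set b := sigma _ _ in bc *; set x := a t; set e := (-1) ^+ n.
  have e1 : e ^+ 2 = 1 by rewrite /e sqrr_sign.
  have -> : (x * - (e * (x * b))) ^+ 2 = (x ^+ 2) ^+ 2 * (e ^+ 2 * b ^+ 2).
    by ring.
  by rewrite e1 bc !mulr1 => /eqP; rewrite sqrp_eq1 ?sqr_ge0// => /eqP.
have [x x1 ax] := smooth_sqr1_cst pA sa a1.
by exists x => // t At; rewrite dac// ax.
Qed.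

End Pairings.

Let generating_unique_at A c d t : proper_interval A -> A `<=` I ->
  generating A c -> generating A d -> A t -> c t = d t ->
  forall s, A s -> c s = d s.
Proof.
move=> pA AI gc gd At cdt s As; have [a a1 dac] := generating_unique pA AI gc gd.
have := dac t At; rewrite -cdt -[X in X = _](scale1r (c t)) => /eqP.
rewrite -subr_eq0 -scalerBl scaler_eq0 (negPf (generating_neq0 pA AI gc At)).
by rewrite orbF subr_eq0 => /eqP a_1; rewrite dac// -a_1 scale1r.
Qed.

Let is_intervalU A J t : is_interval A -> is_interval J -> A t -> J t ->
  is_interval (A `|` J).
Proof.
move=> iA iJ At Jt x y xU yU z /andP[xz zy].
have [zt|tz] := leP z t.
  case: xU => [Ax|Jx]; [left; apply: (iA x t)|right; apply: (iJ x t)] => //;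
    by rewrite xz.
case: yU => [Ay|Jy]; [left; apply: (iA t y)|right; apply: (iJ t y)] => //;
  by rewrite (ltW tz).
Qed.

Let rel_openI A J : rel_open A I -> rel_open J I -> rel_open (A `&` J) I.
Proof.
move=> [AI oA] [JI oJ]; split; first by move=> x [/AI].
move=> t [At Jt]; have := oA t At; have := oJ t Jt.
by apply: filterS2 => s Js As Is; split; [exact: As|exact: Js].
Qed.

(** A generating curve is determined up to sign, so local ones are glued along
    the interval by propagating the choice of the sign. *)
Lemma generating_exists :
  (forall t, I t -> exists J c,
     [/\ rel_open J I, is_interval J, J t & generating J c]) ->
  exists c, generating I c.
Proof.
move=> loc; have [_ [t0 [_ [It0 _ _]]]] := pI.
(* Q t is stable when t moves inside the domain J1 of a local generating
   curve: change its sign on J1 if necessary, and extend by it. *)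
pose Q t := exists J c,
  [/\ rel_open J I, is_interval J, J t0, J t & generating J c].
have Q0 : Q t0.
  by have [J [c [oJ iJ Jt gc]]] := loc t0 It0; exists J, c.
have Qloc t : I t -> \forall s \near t, I s -> (Q s <-> Q t).
  move=> It; have [J1 [c1 [oJ1 iJ1 J1t gc1]]] := loc t It.
  have step s s' : J1 s -> J1 s' -> Q s -> Q s'.
    move=> J1s J1s' [J [c [oJ iJ Jt0 Js gc]]].
    have oJJ1 : rel_open (J `&` J1) I by exact: rel_openI.
    have pJJ1 : proper_interval (J `&` J1).
      apply: (rel_open_proper pI oJJ1); last by exists s.
      exact: is_intervalI.
    have oJJ1J : rel_open (J `&` J1) J.
      by apply: (rel_open_sub oJJ1); [move=> x []|exact: oJ.1].
    have oJJ1J1 : rel_open (J `&` J1) J1.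
      by apply: (rel_open_sub oJJ1); [move=> x []|exact: oJ1.1].
    have gcr := generating_local oJJ1J (fun _ _ => erefl) gc.
    have gc1r := generating_local oJJ1J1 (fun _ _ => erefl) gc1.
    have [a a1 ca] := generating_unique pJJ1 oJJ1.1 gc1r gcr.
    pose w u := if `[< J u >] then c u else a *: c1 u.
    have wc u : J u -> w u = c u by rewrite /w => Ju; case: asboolP.
    have wc1 u : J1 u -> w u = a *: c1 u.
      by rewrite /w => J1u; case: asboolP => // Ju; rewrite ca.
    have oU : rel_open (J `|` J1) I.
      split; first by move=> x [/oJ.1|/oJ1.1].
      move=> u [/oJ.2|/oJ1.2]; first by apply: filterS => v h /h; left.
      by apply: filterS => v h /h; right.
    have oJU : rel_open J (J `|` J1).
      by apply: (rel_open_sub oJ); [move=> x; left|exact: oU.1].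
    have oJ1U : rel_open J1 (J `|` J1).
      by apply: (rel_open_sub oJ1); [move=> x; right|exact: oU.1].
    exists (J `|` J1), w; split => //.
    - exact: (is_intervalU iJ iJ1 Js J1s).
    - by left.
    - by right.
    - apply: generating_glue => u [Ju|J1u]; first by exists J, c.
      exists J1, (fun x => a *: c1 x); split => //.
      apply: generatingZ => //; apply: (rel_open_proper pI oJ1 iJ1).
      by exists s.
  have := oJ1.2 t J1t; apply: filterS => s h /h J1s.
  by split; apply: step.
have Qall := interval_ind pI.1 It0 Q0 Qloc.
(* All the generating curves reaching t0 are normalized by their value at t0,
   so that they agree wherever they are defined. *)
have [Jb [cb [oJb iJb Jbt0 _ gcb]]] := Q0.
have loc0 t : I t -> exists Jc : set R * (R -> W),
    [/\ rel_open Jc.1 I, is_interval Jc.1, Jc.1 t0, Jc.1 t &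
      generating Jc.1 Jc.2 /\ Jc.2 t0 = cb t0].
  move=> /Qall[J [c [oJ iJ Jt0 Jt gc]]].
  have oJJb : rel_open (J `&` Jb) I by exact: rel_openI.
  have pJJb : proper_interval (J `&` Jb).
    apply: (rel_open_proper pI oJJb); last by exists t0.
    exact: is_intervalI.
  have oJJbJ : rel_open (J `&` Jb) J.
    by apply: (rel_open_sub oJJb); [move=> x []|exact: oJ.1].
  have oJJbJb : rel_open (J `&` Jb) Jb.
    by apply: (rel_open_sub oJJb); [move=> x []|exact: oJb.1].
  have gcr := generating_local oJJbJ (fun _ _ => erefl) gc.
  have gcbr := generating_local oJJbJb (fun _ _ => erefl) gcb.
  have [a a1 ca] := generating_unique pJJb oJJb.1 gcr gcbr.
  exists (J, fun x => a *: c x); split => //=; split; last by rewrite ca.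
  by apply: generatingZ => //; apply: (rel_open_proper pI oJ iJ); exists t0.
pose Jc t := if pselect (I t) is left It then projT1 (cid (loc0 t It))
  else (set0, fun=> 0).
have JcP t : I t -> [/\ rel_open (Jc t).1 I, is_interval (Jc t).1,
    (Jc t).1 t0, (Jc t).1 t &
    generating (Jc t).1 (Jc t).2 /\ (Jc t).2 t0 = cb t0].
  by rewrite /Jc => It; case: pselect => // It'; exact: (projT2 (cid (loc0 t It'))).
exists (fun t => (Jc t).2 t); apply: generating_glue => t It.
have [oJ iJ Jt0 Jt [gc ct0]] := JcP t It.
exists (Jc t).1, (Jc t).2; split => // s Js.
have [oJ' iJ' Jt0' Jt' [gc' ct0']] := JcP s (oJ.1 _ Js).
have oJJ : rel_open ((Jc s).1 `&` (Jc t).1) I by exact: rel_openI.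
have pJJ : proper_interval ((Jc s).1 `&` (Jc t).1).
  apply: (rel_open_proper pI oJJ); last by exists t0.
  exact: is_intervalI.
have oJJs : rel_open ((Jc s).1 `&` (Jc t).1) (Jc s).1.
  by apply: (rel_open_sub oJJ); [move=> x []|exact: oJ'.1].
have oJJt : rel_open ((Jc s).1 `&` (Jc t).1) (Jc t).1.
  by apply: (rel_open_sub oJJ); [move=> x []|exact: oJ.1].
have gcs := generating_local oJJs (fun _ _ => erefl) gc'.
have gct := generating_local oJJt (fun _ _ => erefl) gc.
apply: (generating_unique_at (t := t0) pJJ oJJ.1 gcs gct) => //.
by rewrite ct0 ct0'.
Qed.

End GeneratingCurves.

(** * Darboux bases, velocity, and the frame of a generating curve *)

Section DarbouxBases.
Context {R : realType} {W : vectType R} {m : nat}.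
Variable sigma : {skew_symmetric W}.
Hypothesis dimW : \dim {:W} = (2 * m)%N.
Hypothesis nondeg : forall w, (forall v, sigma w v = 0) -> w = 0.
Implicit Types (e f : 'I_m -> W) (w : W).

Lemma codom_mktuple e : codom e = [tuple e i | i < m] :> seq W.
Proof. by rewrite codomE -val_ord_tuple. Qed.

Lemma free_codomP e : (forall k : 'I_m -> R, \sum_i k i *: e i = 0 -> k =1 (fun=> 0)) ->
  free (codom e).
Proof.
move=> H; rewrite codom_mktuple; apply/freeP => k ke; apply: H.
by rewrite -[RHS]ke; apply: eq_bigr => i _; rewrite -tnth_nth tnth_mktuple.
Qed.

Lemma mem_span_codom e w : w \in <<codom e>>%VS ->
  exists k : 'I_m -> R, w = \sum_i k i *: e i.
Proof.
rewrite codom_mktuple => /coord_span ->.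
exists (fun i => coord [tuple e i | i < m] i w).
by apply: eq_bigr => i _; rewrite -tnth_nth tnth_mktuple.
Qed.

Lemma codom_memv e i : e i \in <<codom e>>%VS.
Proof. by rewrite memv_span// codom_f. Qed.

Lemma darboux_of_pairings e f :
  (forall i j, sigma (e i) (e j) = 0) -> (forall i j, sigma (f i) (f j) = 0) ->
  (forall i j, sigma (f i) (e j) = (i == j)%:R) -> darboux_basis sigma e f.
Proof.
move=> ee ff fe; split => //.
have pick k j : \sum_i k i * sigma (f i) (e j) = k j.
  rewrite (bigD1 j)//= fe eqxx mulr1 big1 ?addr0// => i ij.
  by rewrite fe (negPf ij) mulr0.
have pick' k j : \sum_i k i * sigma (f j) (e i) = k j.
  rewrite (bigD1 j)//= fe eqxx mulr1 big1 ?addr0// => i ij.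
  by rewrite fe eq_sym (negPf ij) mulr0.
rewrite basisEfree subvf size_cat !size_codom card_ord dimW addnn mul2n leqnn.
rewrite !andbT cat_free; apply/and3P; split.
- apply: free_codomP => k ke j.
  have := congr1 (sigma (f j)) ke; rewrite linear0r skew_sumr => <-.
  by rewrite -[LHS]pick'; apply: eq_bigr => i _; rewrite skewZr.
- apply: free_codomP => k kf j.
  have := congr1 (fun x => sigma x (e j)) kf; rewrite /= linear0l skew_suml => <-.
  by rewrite -[LHS]pick; apply: eq_bigr => i _; rewrite skewZl.
- apply/directv_addP/eqP; rewrite -subv0; apply/subvP => w.
  rewrite memv_cap => /andP[/mem_span_codom[a wa] /mem_span_codom[b wb]].
  rewrite memv0 wb big1// => j _.
  suff -> : b j = 0 by rewrite scale0r.
  rewrite -[LHS]pick; transitivity (sigma w (e j)).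
    by rewrite wb skew_suml; apply: eq_bigr => i _; rewrite skewZl.
  by rewrite wa skew_suml big1// => i _; rewrite skewZl ee mulr0.
Qed.

Lemma darboux_nondeg e f w : darboux_basis sigma e f ->
  (forall i, sigma w (e i) = 0) -> (forall i, sigma w (f i) = 0) -> w = 0.
Proof.
case=> bef _ _ _ we wf; apply: nondeg => v.
have := memvf v; rewrite -(span_basis bef) span_cat => /memv_addP[x xe [y yf ->]].
have [a ->] := mem_span_codom xe; have [b ->] := mem_span_codom yf.
rewrite skewDr !skew_sumr !big1 ?addr0// => i _.
  by rewrite skewZr wf mulr0.
by rewrite skewZr we mulr0.
Qed.

Lemma darboux_span_lagrangian (L : {vspace W}) e f : darboux_basis sigma e f ->
  (forall i, e i \in L) -> \dim L = m -> L = <<codom e>>%VS.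
Proof.
case=> bef _ _ _ eL dL; apply/esym/eqP; rewrite eqEdim dL; apply/andP; split.
  by apply/span_subvP => _ /codomP[i ->]; exact: eL.
have := basis_free bef; rewrite cat_free => /and3P[fe _ _].
by move: fe; rewrite /free => /eqP ->; rewrite size_codom card_ord.
Qed.

End DarbouxBases.

Section Velocity.
Context {R : realType} {W : vectType R}.
Variable sigma : {skew_symmetric W}.
Variables (I : set R) (Lam : R -> {vspace W}).
Hypothesis pI : proper_interval I.
Hypothesis isoL : forall t, I t -> {in Lam t &, forall u v, sigma u v = 0}.

(** For two curves through the same vector of Lam t, differentiate their
    vanishing pairing. *)
Lemma velocity_indep (A : set R) (c d : R -> W) t : proper_interval A ->
  A `<=` I -> smooth_curve A c -> smooth_curve A d ->
  (forall s, A s -> c s \in Lam s) -> (forall s, A s -> d s \in Lam s) ->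
  A t -> c t = d t ->
  sigma (curve_derive A c t) (c t) = sigma (curve_derive A d t) (d t).
Proof.
move=> pA AI sc sd cL dL At cdt.
have cd0 s : A s -> sigma (c s) (d s) = 0.
  by move=> As; exact: isoL (AI _ As) _ _ (cL s As) (dL s As).
have := skew_derive_cst pA sc sd cd0 At.
by rewrite -cdt skewC => /oppr_inj ->.
Qed.

(** The velocity is defined by choosing a curve through the given vector; the
    value does not depend on this choice. *)
Lemma velocityE (c : R -> W) t : smooth_curve I c ->
  (forall s, I s -> c s \in Lam s) -> I t ->
  velocity sigma I Lam t (c t) = sigma (curve_derive I c t) (c t).
Proof.
move=> sc cL It; rewrite /velocity; set P := (X in xget _ X).
have : P (xget 0 P).
  by apply: xgetPex; exists (sigma (curve_derive I c t) (c t)), c; split.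
move=> [d [sd dL dt ->]]; rewrite -{1}dt; apply: velocity_indep => //.
Qed.

End Velocity.

Section NormalFrames.
Context {R : realType} {W : vectType R} {m : nat}.
Variable sigma : {skew_symmetric W}.
Variables (I : set R) (Lam : R -> {vspace W}).
Hypothesis m_gt0 : (0 < m)%N.
Hypothesis dimW : \dim {:W} = (2 * m)%N.
Hypothesis nondeg : forall w, (forall v, sigma w v = 0) -> w = 0.
Hypothesis pI : proper_interval I.
Hypothesis isoL : forall t, I t -> {in Lam t &, forall u v, sigma u v = 0}.
Hypothesis dimL : forall t, I t -> \dim (Lam t) = m.
Implicit Types (c d : R -> W) (t : R) (E F : 'I_m -> R -> W).

Local Notation D := (curve_derive I).
Local Notation "c ^: n" := (curve_derive_n I n c) (at level 8).

Section FrameOfGenerating.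
Variables (c : R -> W) (s : R).
Hypothesis gc : generating (m := m) sigma Lam I c.
Hypothesis s1 : s ^+ 2 = 1.
Hypothesis sE : forall t, I t ->
  sigma (curve_derive_n I m c t) (curve_derive_n I m.-1 c t) = s.

(** The vectors F_m, F_(m-1), ..., F_1 of the frame, in this order; since
    E_i = c^(i-1), the index k stands for F_(m-k), which is dual to
    c^(m-1-k).  The coefficient in the recursion is the only one that makes
    consecutive vectors orthogonal. *)
Fixpoint dual_curve k : R -> W :=
  if k is k'.+1 then
    fun t => sigma (dual_curve k' t) (D (dual_curve k') t) *: c^:(m.-1 - k') t
      - D (dual_curve k') t
  else fun t => s *: c^:m t.

Definition dual_coef k t := sigma (dual_curve k t) (D (dual_curve k) t).

Let sc : smooth_curve I c. Proof. by case: gc. Qed.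

Lemma smooth_dual_curve k : smooth_curve I (dual_curve k).
Proof.
elim: k => [|k IH] /=.
  exact: (smooth_curveZc (a := s) pI (smooth_curve_derive_n (n := m) pI sc)).
have sD := smooth_curve_derive pI IH.
have sl := smooth_skew (sigma := sigma) pI IH sD.
have sE' := smooth_curve_derive_n (n := m.-1 - k) pI sc.
have sN := smooth_curveZc (a := -1) pI sD.
apply: (smooth_curve_eq _ (smooth_curveD pI (smooth_curveZ pI sl sE') sN)).
by move=> t It; rewrite scaleN1r.
Qed.
Arguments smooth_dual_curve : clear implicits.

Lemma smooth_dual_coef k : smooth_within I (dual_coef k).
Proof.
have sG := smooth_dual_curve k.
exact: (smooth_skew (sigma := sigma) pI sG (smooth_curve_derive pI sG)).
Qed.

Let dual_derive k t :
  D (dual_curve k) t = dual_coef k t *: c^:(m.-1 - k) t - dual_curve k.+1 t.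
Proof. by rewrite /= opprB addrC subrK. Qed.

Let smooth_cn n : smooth_curve I (c^:n).
Proof. exact: smooth_curve_derive_n. Qed.
Arguments smooth_cn : clear implicits.

Let cn_iso i j t : I t -> (i < m)%N -> (j < m)%N ->
  sigma (c^:i t) (c^:j t) = 0.
Proof.
move=> It im jm; case: gc => _ cL _.
by apply: (isoL It); apply: cL.
Qed.

Let cm_dual t : c^:m t = s *: dual_curve 0 t.
Proof. by rewrite /= scalerA -expr2 s1 scale1r. Qed.

(** For j < m - 1 and l < k, move the derivative contained in the vector of index
    k + 1 to the other argument, and use the relations for smaller indices; the
    pairing with the vector of index k vanishes by the choice of the
    coefficient.  For j = m - 1, the derivative of c^(j) is a multiple of F_m. *)
Lemma dual_curve_pairings k t : (k < m)%N -> I t ->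
  (forall j, (j < m)%N ->
     sigma (dual_curve k t) (c^:j t) = (j == m.-1 - k)%N%:R) /\
  (forall l, (l <= k)%N -> sigma (dual_curve k t) (dual_curve l t) = 0).
Proof.
elim/ltn_ind: k t => k IH t km It.
case: k => [|k] in IH km *.
  split=> [j jm|l]; last by rewrite leqn0 => /eqP ->; exact: skew_self.
  rewrite subn0 /= skewZl; have [->|jm1] := eqVneq j m.-1.
    by rewrite sE// -expr2 s1.
  have [_ _ _] := gc.
  rewrite (generating_pair0 m_gt0 dimW isoL pI (@subset_refl _ I) gc gc It) ?mulr0//.
  by lia.
have IHk u := IH k (ltnSn k) u (ltnW km).
have bk j u : I u -> (j < m)%N ->
    sigma (dual_curve k u) (c^:j u) = (j == m.-1 - k)%N%:R.
  by move=> Iu jm; exact: (IHk u Iu).1.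
have ck l u : I u -> (l <= k)%N -> sigma (dual_curve k u) (dual_curve l u) = 0.
  by move=> Iu lk; exact: (IHk u Iu).2.
have km1 : (m.-1 - k < m)%N by lia.
split=> [j jm|l lk].
  have step : sigma (dual_curve k.+1 t) (c^:j t) =
      sigma (dual_curve k t) (c^:j.+1 t).
    rewrite /= skewDl skewZl skewNl cn_iso// mulr0 add0r.
    by rewrite (skew_derive_cst pI (smooth_dual_curve k) (smooth_cn j)
      (fun u Iu => bk j u Iu jm) It).
  rewrite step; have [jm'|mj] := ltnP j.+1 m.
    by rewrite bk//; congr (nat_of_bool _)%:R; apply/eqP/eqP; lia.
  have -> : j.+1 = m by lia.
  by rewrite cm_dual skewZr ck// mulr0; case: eqP => //; lia.
move: lk; rewrite leq_eqVlt => /orP[/eqP ->|]; first exact: skew_self.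
rewrite ltnS => lk; rewrite [X in sigma X _]/= skewDl skewZl skewNl.
have [lk'|lk'] := eqVneq l k.
  subst l; rewrite (skewC sigma (c^:_ t)) bk// eqxx mulrN1.
  by rewrite (skewC sigma (D _ t)) opprK addNr.
have ltlk : (l < k)%N by rewrite ltn_neqAle lk' lk.
have bl := (IH l (ltn_trans ltlk (ltnSn k)) t (leq_ltn_trans lk (ltnW km)) It).1.
rewrite (skewC sigma (c^:_ t)) bl//.
have -> : (m.-1 - k == m.-1 - l)%N = false by apply/eqP; lia.
rewrite oppr0 mulr0 add0r.
rewrite -(skew_derive_cst pI (smooth_dual_curve k) (smooth_dual_curve l)
  (fun u Iu => ck l u Iu lk) It) dual_derive skewDr skewNr skewZr ck//.
rewrite bk//; last by lia.
have -> : (m.-1 - l == m.-1 - k)%N = false by apply/eqP; lia.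
by rewrite mulr0 subr0.
Qed.

Definition generated_frame (i : 'I_m) : R -> W := c^:i.
Definition dual_frame (i : 'I_m) : R -> W := dual_curve (rev_ord i).

Lemma generated_darboux t : I t ->
  darboux_basis sigma (generated_frame^~ t) (dual_frame^~ t).
Proof.
move=> It; apply: darboux_of_pairings => //.
- by move=> i j; exact: cn_iso.
- move=> i j; rewrite /dual_frame.
  have [_ Hi] := dual_curve_pairings (ltn_ord (rev_ord i)) It.
  have [_ Hj] := dual_curve_pairings (ltn_ord (rev_ord j)) It.
  have [/Hi//|ji] := leqP (rev_ord j) (rev_ord i).
  by rewrite skewC Hj ?oppr0//; exact: ltnW.
- move=> i j; rewrite /dual_frame /generated_frame.
  have [-> //] := dual_curve_pairings (ltn_ord (rev_ord i)) It.
  move=> _; have -> : (i == j) = (j == i :> nat) by rewrite eq_sym.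
  have im := ltn_ord i; congr (nat_of_bool _)%:R => /=.
  by apply/eqP/eqP; lia.
Qed.

(** The derivative of F_1 is orthogonal to all the vectors of the frame except
    F_1. *)
Lemma dual_curve_last t : I t ->
  D (dual_curve m.-1) t = dual_coef m.-1 t *: c t.
Proof.
move=> It; apply/eqP; rewrite -subr_eq0; apply/eqP.
have mm : (m.-1 < m)%N by rewrite prednK.
have PP u := dual_curve_pairings mm (t := u).
apply: (darboux_nondeg nondeg (generated_darboux It)) => i.
  rewrite /generated_frame skewDl skewNl skewZl.
  rewrite (cn_iso (i := 0)) ?ltn_ord// mulr0 subr0.
  have H := skew_derive_cst (sigma := sigma) pI (smooth_dual_curve m.-1)
    (smooth_cn i) (fun u Iu => (PP u Iu).1 i (ltn_ord i)) It.
  apply: oppr_inj; rewrite -H oppr0 -[D (c^:i) t]/(c^:i.+1 t).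
  have [im|mi] := ltnP i.+1 m.
    by rewrite (PP t It).1// subnn.
  have -> : i.+1 = m by have := ltn_ord i; lia.
  by rewrite cm_dual skewZr (PP t It).2// mulr0.
rewrite /dual_frame; set l := nat_of_ord (rev_ord i).
have lm : (l < m)%N by exact: ltn_ord.
have Pl := (dual_curve_pairings lm It).1 0%N m_gt0.
rewrite skewDl skewNl skewZl (skewC sigma (c t)) Pl.
have lm1 : (l <= m.-1)%N by lia.
have [lE|lm2] := eqVneq l m.-1.
  rewrite lE subnn eqxx mulrN1 opprK /dual_coef.
  by rewrite skewC addNr.
have -> : (0 == m.-1 - l)%N = false by apply/eqP; move/eqP : lm2; lia.
rewrite oppr0 mulr0 subr0.
have H := skew_derive_cst (sigma := sigma) pI (smooth_dual_curve m.-1)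
    (smooth_dual_curve l) (fun u Iu => (PP u Iu).2 l lm1) It.
apply: oppr_inj; rewrite -H oppr0 dual_derive skewDr skewNr skewZr (PP t It).1; last by lia.
rewrite (PP t It).2; last by move/eqP : lm2; lia.
have -> : (m.-1 - l == m.-1 - m.-1)%N = false.
  by apply/eqP; move/eqP : lm2; lia.
by rewrite mulr0 subr0.
Qed.

Lemma generated_normal_frame :
  normal_darboux_frame sigma I Lam generated_frame dual_frame.
Proof.
have [_ cL _] := gc.
have mm : (m.-1 < m)%N by rewrite prednK.
split.
- split=> [i|i|t]; [exact: smooth_cn|exact: smooth_dual_curve|].
  exact: generated_darboux.
- move=> t It; apply: (darboux_span_lagrangian (generated_darboux It)).
    by move=> i; apply: cL.
  exact: dimL.
exists s, (fun k : 'I_m => dual_coef k); split.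
- by move/eqP : s1; rewrite sqrf_eq1 => /orP[] /eqP; [left|right].
- move=> t It.
  (* The sign is the value of the velocity at E_m. *)
  have vE : velocity sigma I Lam t (c^:m.-1 t) = s.
    rewrite (velocityE pI isoL (smooth_cn _) _ It); last first.
      by move=> u Iu; exact: cL.
    by rewrite -(sE It) -[in c^:m](prednK m_gt0).
  have mL : c^:m.-1 t \in Lam t by exact: cL.
  move/eqP : s1; rewrite sqrf_eq1 => /orP[] /eqP s_1; split => // H.
    by have := H _ mL; rewrite vE s_1 ler10.
  by have := H _ mL; rewrite vE s_1 oppr_ge0 ler10.
- by move=> i; exact: smooth_dual_coef.
- move=> t It; split.
  + by move=> i j ij; rewrite /generated_frame ij.
  + move=> i im; rewrite /generated_frame /dual_frame /= im subnn.
    by rewrite -cm_dual -[in RHS]im.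
  + move=> i i0; rewrite /dual_frame /generated_frame /= i0 subn1.
    exact: dual_curve_last.
  + move=> i j ij; rewrite /dual_frame /generated_frame dual_derive.
    have jm := ltn_ord j.
    have -> : (m.-1 - rev_ord j)%N = j by rewrite /=; lia.
    by have -> : (rev_ord j).+1 = rev_ord i by rewrite /=; lia.
Qed.

End FrameOfGenerating.

End NormalFrames.

(** * Uniqueness of normal frames *)

Section FrameUniqueness.
Context {R : realType} {W : vectType R} {m : nat}.
Variable sigma : {skew_symmetric W}.
Variables (I : set R) (Lam : R -> {vspace W}).
Hypothesis m_gt0 : (0 < m)%N.
Hypothesis dimW : \dim {:W} = (2 * m)%N.
Hypothesis nondeg : forall w, (forall v, sigma w v = 0) -> w = 0.
Hypothesis pI : proper_interval I.
Hypothesis isoL : forall t, I t -> {in Lam t &, forall u v, sigma u v = 0}.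
Hypothesis dimL : forall t, I t -> \dim (Lam t) = m.
Implicit Types (E F : 'I_m -> R -> W) (t : R).

Local Notation D := (curve_derive I).
Local Notation Dn := (curve_derive_n I).
Local Notation normal := (normal_darboux_frame sigma I Lam).

Let i0 : 'I_m := Ordinal m_gt0.
Let imax_lt : (m.-1 < m)%N. Proof. by rewrite prednK. Qed.
Let imax : 'I_m := Ordinal imax_lt.

Lemma normal_frame_derive_n E F i t : normal E F -> I t ->
  E i t = Dn i (E i0) t.
Proof.
move=> [_ _ [s [lam [_ _ _ st]]]].
elim: i => i im; elim: i im t => [|i IH] im t It.
  by rewrite /=; congr (E _ t); exact: val_inj.
have [E1 _ _ _] := st t It.
rewrite -(E1 (Ordinal (ltnW im)) (Ordinal im) erefl) /=.
by apply: (curve_derive_eq _ It) => u Iu; rewrite IH.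
Qed.

Lemma normal_frame_last E F : normal E F -> exists2 s : R, s ^+ 2 = 1 &
  forall t, I t -> Dn m (E i0) t = s *: F imax t.
Proof.
move=> nEF; have [_ _ [s [lam [s1 _ _ st]]]] := nEF.
exists s; first by case: s1 => ->; rewrite ?sqrrN expr1n.
move=> t It; have [_ E2 _ _] := st t It.
rewrite -(E2 imax (prednK m_gt0)) -[in LHS](prednK m_gt0) /=.
apply: (curve_derive_eq _ It) => u Iu.
by rewrite (normal_frame_derive_n imax nEF Iu).
Qed.

Lemma normal_frame_generating E F : normal E F ->
  generating (m := m) sigma Lam I (E i0).
Proof.
move=> nEF; have [[sE sF dEF] spanE _] := nEF; split.
- exact: sE.
- move=> t It j jm; rewrite -(normal_frame_derive_n (Ordinal jm) nEF It).
  by rewrite spanE// codom_memv.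
- move=> t It; have [s s1 ->//] := normal_frame_last nEF.
  have [_ _ _ FE] := dEF t It.
  by rewrite -(normal_frame_derive_n imax nEF It) skewZl FE eqxx mulr1.
Qed.

(** The first vectors agree up to sign, hence so do all the E_i and F_m; the
    F_i follow downwards because consecutive ones are orthogonal, which
    determines the coefficients of the structural equation. *)
Lemma normal_frame_unique E F E' F' : normal E F -> normal E' F' ->
  exists2 a : R, a ^+ 2 = 1 &
    forall t, I t -> forall i, E' i t = a *: E i t /\ F' i t = a *: F i t.
Proof.
move=> nEF nEF'.
have gE := normal_frame_generating nEF.
have gE' := normal_frame_generating nEF'.
have [a a1 E'0] := generating_unique m_gt0 dimW nondeg isoL pI
  (@subset_refl _ I) gE gE'.
have [[sE sF dEF] _ [s0 [lam [_ _ _ st]]]] := nEF.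
have [[sE' sF' dEF'] _ [s0' [lam' [_ _ _ st']]]] := nEF'.
have E'nE n t : I t -> Dn n (E' i0) t = a *: Dn n (E i0) t.
  move=> It; rewrite -(curve_derive_nZ n a pI (sE i0) It).
  exact: (curve_derive_n_local n (rel_open_refl I) E'0 It).
have E'E i t : I t -> E' i t = a *: E i t.
  move=> It; rewrite (normal_frame_derive_n i nEF' It) E'nE//.
  by rewrite -(normal_frame_derive_n i nEF It).
have [s s1 sEF] := normal_frame_last nEF.
have [s' s'1 sEF'] := normal_frame_last nEF'.
(* sigma(E_m', E_m) is quadratic, so it is not affected by the factor a. *)
have ss t : I t -> s' = s.
  move=> It; have [_ _ _ /(_ imax imax)] := dEF' t It.
  have [_ _ _ /(_ imax imax)] := dEF t It; rewrite eqxx => FE FE'.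
  have : sigma (Dn m (E' i0) t) (E' imax t) = s' by rewrite sEF'// skewZl FE' mulr1.
  by rewrite E'nE// E'E// sEF// skewZl skewZl skewZr FE mulr1 mulrCA -expr2 a1 mulr1.
have F'm t : I t -> F' imax t = a *: F imax t.
  move=> It; have := sEF' t It; rewrite E'nE// sEF// (ss t It) scalerA mulrC.
  move=> /(congr1 (fun x => s *: x)); rewrite !scalerA mulrA -expr2 s1 mul1r.
  by rewrite scale1r.
exists a => //.
suff F'F k t (i : 'I_m) : I t -> i = (m.-1 - k)%N :> nat ->
    F' i t = a *: F i t.
  move=> t It i; split; first exact: E'E.
  apply: (F'F (m.-1 - i)%N) => //; have := ltn_ord i; lia.
elim: k t i => [|k IH] t i It ik.
  by have -> : i = imax; [apply: val_inj; rewrite /= ik subn0|exact: F'm].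
have [km|mk] := ltnP k m.-1; last first.
  by apply: IH => //; rewrite ik; lia.
have jm : (i.+1 < m)%N by lia.
pose j := Ordinal jm.
have F'j u : I u -> F' j u = a *: F j u.
  by move=> Iu; apply: IH => //=; rewrite ik; lia.
have [_ _ _ /(_ i j erefl) Fj] := st t It.
have [_ _ _ /(_ i j erefl) F'j'] := st' t It.
have DF' : D (F' j) t = a *: D (F j) t.
  by rewrite (curve_derive_eq F'j It) (curve_deriveZc pI a (sF j) It).
set mu := lam' (rev_ord j) t - lam (rev_ord j) t.
(* The two structural equations for the index j differ by a multiple of E_j. *)
have F'i : F' i t = a *: F i t + (a * mu) *: E j t.
  have -> : F' i t = lam' (rev_ord j) t *: (a *: E j t) -
      a *: (lam (rev_ord j) t *: E j t - F i t).
    by rewrite -Fj -DF' F'j' E'E// opprB addrC subrK.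
  rewrite /mu scalerBr opprB !scalerA mulrBr scalerBl.
  by rewrite [_ * a]mulrC addrCA.
have [_ _ FF FE] := dEF t It; have [_ _ FF' _] := dEF' t It.
have : sigma (F' i t) (F' j t) = 0 by exact: FF'.
rewrite F'i F'j// skewDl !skewZl !skewZr FF !mulr0 add0r.
rewrite skewC FE eqxx mulrN1 => /eqP.
rewrite mulrN oppr_eq0 mulrAC -expr2 a1 mul1r => /eqP mu0.
by rewrite mu0 mulr0 scale0r addr0.
Qed.

Lemma normal_frameZ E F E' F' (a : R) : a ^+ 2 = 1 -> normal E F ->
  (forall t, I t -> forall i, E' i t = a *: E i t /\ F' i t = a *: F i t) ->
  normal E' F'.
Proof.
move=> a1 [[sE sF dEF] spanE [s [lam [s1 sv slam st]]]] EF'.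
have E'E i t : I t -> E' i t = a *: E i t by move=> It; case: (EF' t It i).
have F'F i t : I t -> F' i t = a *: F i t by move=> It; case: (EF' t It i).
have DE i t : I t -> D (E' i) t = a *: D (E i) t.
  move=> It; rewrite -(curve_deriveZc pI a (sE i) It).
  exact: curve_derive_eq (E'E i) It.
have DF i t : I t -> D (F' i) t = a *: D (F i) t.
  move=> It; rewrite -(curve_deriveZc pI a (sF i) It).
  exact: curve_derive_eq (F'F i) It.
have dEF' t : I t -> darboux_basis sigma (E'^~ t) (F'^~ t).
  move=> It; have [_ EE FF FE] := dEF t It.
  apply: darboux_of_pairings => // i j; rewrite ?E'E ?F'F// skewZl skewZr.
  - by rewrite EE !mulr0.
  - by rewrite FF !mulr0.
  - by rewrite FE mulrA -expr2 a1 mul1r.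
split.
- split=> [i|i|//].
    exact: smooth_curve_eq (E'E i) (smooth_curveZc (a := a) pI (sE i)).
  exact: smooth_curve_eq (F'F i) (smooth_curveZc (a := a) pI (sF i)).
- move=> t It; apply: (darboux_span_lagrangian (dEF' t It)); last exact: dimL.
  by move=> i; rewrite E'E// memvZ// spanE// codom_memv.
- exists s, lam; split => // t It; have [E1 E2 F1 F2] := st t It; split.
  + by move=> i j ij; rewrite DE// (E1 i j ij) E'E.
  + by move=> i im; rewrite DE// E2// F'F// !scalerA mulrC.
  + by move=> i i_0; rewrite DF// F1// E'E// !scalerA mulrC.
  + move=> i j ij; rewrite DF// (F2 i j ij) E'E// F'F// scalerBr !scalerA.
    by rewrite mulrC.
Qed.

End FrameUniqueness.

(** * Graphs over a Darboux basis, and global sections *)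

Section Graphs.
Context {R : realType} {W : vectType R} {m : nat}.
Variable sigma : {skew_symmetric W}.
Variables (e f : 'I_m -> W).
Hypothesis dar : darboux_basis sigma e f.
Implicit Types (S T : 'M[R]_m) (x : 'I_m -> R).

Definition graph_vec S i : W := e i + \sum_k S k i *: f k.

Lemma graph_comb S x : \sum_i x i *: graph_vec S i =
  \sum_i x i *: e i + \sum_k (\sum_i S k i * x i) *: f k.
Proof.
under eq_bigr do rewrite scalerDr scaler_sumr.
rewrite big_split /=; congr (_ + _); rewrite exchange_big /=.
apply: eq_bigr => k _; rewrite scaler_suml; apply: eq_bigr => i _.
by rewrite scalerA mulrC.
Qed.

Lemma is_graphP S (L : {vspace W}) : is_graph e f S L ->
  forall w, w \in L <-> exists x, w = \sum_i x i *: graph_vec S i.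
Proof.
move=> gS w; rewrite gS; split=> [[x ->]|[x ->]].
  by exists (fun i => x i 0); rewrite graph_comb; congr (_ + _);
    apply: eq_bigr => k _; rewrite mxE.
exists (\col_i x i); rewrite graph_comb; congr (_ + _); apply: eq_bigr => k _.
  by rewrite mxE.
by rewrite mxE; congr (_ *: _); apply: eq_bigr => i _; rewrite mxE.
Qed.

Lemma graph_vec_mem S (L : {vspace W}) i : is_graph e f S L ->
  graph_vec S i \in L.
Proof.
move=> /is_graphP ->; exists (fun j => (j == i)%:R).
rewrite (bigD1 i)//= eqxx scale1r big1 ?addr0// => j /negPf ->.
by rewrite scale0r.
Qed.

Let sum_delta (F : 'I_m -> R) j : \sum_k F k * (k == j)%:R = F j.
Proof.
rewrite (bigD1 j)//= eqxx mulr1 big1 ?addr0// => k /negPf ->.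
by rewrite mulr0.
Qed.

Lemma skew_dual_graph S k i : sigma (f k) (graph_vec S i) = (k == i)%:R.
Proof.
case: dar => _ _ ff fe; rewrite skewDr fe skew_sumr big1 ?addr0// => l _.
by rewrite skewZr ff mulr0.
Qed.

Lemma skew_graph S T i j :
  sigma (graph_vec S i) (graph_vec T j) = S j i - T i j.
Proof.
rewrite skewDl skew_suml addrC; congr (_ + _).
  rewrite -[RHS](sum_delta (fun k => S k i)); apply: eq_bigr => k _.
  by rewrite skewZl skew_dual_graph.
case: dar => _ ee _ fe; rewrite skewDr ee add0r skewC; congr (- _).
rewrite skew_suml -[RHS](sum_delta (fun k => T k j)); apply: eq_bigr => k _.
by rewrite skewZl fe.
Qed.

Lemma graph_coord S x k : sigma (f k) (\sum_i x i *: graph_vec S i) = x k.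
Proof.
rewrite skew_sumr -[RHS](sum_delta x); apply: eq_bigr => i _.
by rewrite skewZr skew_dual_graph eq_sym.
Qed.

End Graphs.

Section GlobalSections.
Context {R : realType} {W : vectType R}.
Implicit Types (u v w : W) (L : {vspace W}).

(** The Euclidean scalar product in which the reference basis of W is
    orthonormal; orthogonal projections onto the subspaces Lam t provide
    sections of the curve that are defined everywhere. *)
Definition euclid u v : R := \sum_(i < \dim {:W})
  coord (vbasis {:W}) i u * coord (vbasis {:W}) i v.

Lemma euclidC u v : euclid u v = euclid v u.
Proof. by apply: eq_bigr => i _; rewrite mulrC. Qed.

Lemma euclidDl u v w : euclid (u + v) w = euclid u w + euclid v w.
Proof.
by rewrite -big_split; apply: eq_bigr => i _ /=; rewrite linearD mulrDl.
Qed.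

Lemma euclidZl (a : R) u w : euclid (a *: u) w = a * euclid u w.
Proof.
by rewrite big_distrr; apply: eq_bigr => i _ /=; rewrite linearZ mulrA.
Qed.

Lemma euclidBl u v w : euclid (u - v) w = euclid u w - euclid v w.
Proof. by rewrite -scaleN1r euclidDl euclidZl mulN1r. Qed.

Lemma euclid_suml (T : finType) (F : T -> W) w :
  euclid (\sum_i F i) w = \sum_i euclid (F i) w.
Proof.
have e0 : euclid 0 w = 0 by rewrite -(scale0r 0) euclidZl mul0r.
by elim/big_rec2 : _ => [//|i x y _ <-]; rewrite euclidDl.
Qed.

Lemma euclid_sumr (T : finType) (F : T -> W) w :
  euclid w (\sum_i F i) = \sum_i euclid w (F i).
Proof.
by rewrite euclidC euclid_suml; apply: eq_bigr => i _; rewrite euclidC.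
Qed.

Lemma euclid_eq0 u : euclid u u = 0 -> u = 0.
Proof.
move=> /eqP; rewrite psumr_eq0 => [/allP u0|i _]; last by rewrite -expr2 sqr_ge0.
rewrite (coord_vbasis (memvf u)) big1// => i _.
have := u0 i (mem_index_enum _); rewrite /= mulf_eq0 orbb => /eqP ->.
by rewrite scale0r.
Qed.

Definition orthoproj L w : W :=
  xget 0 [set p | p \in L /\ forall z, z \in L -> euclid (w - p) z = 0].

Lemma orthoprojP L w p : p \in L ->
  (forall z, z \in L -> euclid (w - p) z = 0) -> orthoproj L w = p.
Proof.
move=> pL pw; rewrite /orthoproj; set P := (X in xget _ X).
have [qL qw] : P (xget 0 P) by apply: xgetPex; exists p.
set q := xget 0 P in qL qw *.
have qpL : q - p \in L by rewrite memvB.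
apply/eqP; rewrite -subr_eq0; apply/eqP/euclid_eq0.
have -> : euclid (q - p) (q - p) = euclid (w - p) (q - p) - euclid (w - q) (q - p).
  rewrite -euclidBl; congr (euclid _ _).
  by rewrite opprB [RHS]addrC addrA subrK.
by rewrite pw// qw// subrr.
Qed.

Lemma smooth_euclid A (c d : R -> W) : proper_interval A -> smooth_curve A c ->
  smooth_curve A d -> smooth_within A (fun t => euclid (c t) (d t)).
Proof.
move=> pA /(smooth_curve_coord _ pA) sc /(smooth_curve_coord _ pA) sd.
by apply: (smooth_sum pA) => i _; exact: smoothM pA _ _ (sc i) (sd i).
Qed.

End GlobalSections.

Section ChartSections.
Context {R : realType} {W : vectType R} {m : nat}.
Variable sigma : {skew_symmetric W}.
Variables (I J : set R) (Lam : R -> {vspace W}).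
Variables (e f : 'I_m -> W) (S : R -> 'M[R]_m).
Hypothesis dar : darboux_basis sigma e f.
Hypothesis pJ : proper_interval J.
Hypothesis gS : forall s, J s -> is_graph e f (S s) (Lam s).
Hypothesis sS : smooth_entries J S.

Lemma smooth_graph_vec i : smooth_curve J (fun s => graph_vec e f (S s) i).
Proof.
apply: (smooth_curveD pJ (smooth_curve_cst pJ (w := e i))).
apply: (smooth_curve_sum pJ) => k.
exact (smooth_curveZ pJ (@sS k i) (smooth_curve_cst pJ (w := f k))).
Qed.

Lemma derive_graph_vec i t : J t ->
  curve_derive J (fun s => graph_vec e f (S s) i) t =
  \sum_k derive_within J (fun s => S s k i) t *: f k.
Proof.
move=> Jt; have sSf k : smooth_curve J (fun s => S s k i *: f k).
  exact (smooth_curveZ pJ (@sS k i) (smooth_curve_cst pJ (w := f k))).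
rewrite (curve_deriveD pJ (smooth_curve_cst pJ (w := e i))
  (smooth_curve_sum pJ (r := index_enum _) sSf) Jt).
rewrite curve_derive_cst// add0r (curve_derive_sum pJ _ Jt sSf).
apply: eq_bigr => k _.
rewrite (curve_deriveZ pJ (@sS k i) (smooth_curve_cst pJ (w := f k)) Jt).
by rewrite curve_derive_cst// scaler0 addr0.
Qed.

(** The projection of w is the combination of the moving basis of the graph whose
    coefficients are given by the inverse of the Gram matrix of this basis. *)
Lemma smooth_orthoproj w : smooth_curve J (fun s => orthoproj (Lam s) w) /\
  forall s, J s -> orthoproj (Lam s) w \in Lam s.
Proof.
pose l i s := graph_vec e f (S s) i.
have sl i : smooth_curve J (l i) by exact: smooth_graph_vec.
pose G s : 'M[R]_m := \matrix_(i, j) euclid (l i s) (l j s).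
have sG : smooth_entries J G.
  by move=> i j; under eq_fun do rewrite mxE; exact: smooth_euclid.
have G0 s : \det (G s) != 0.
  apply/negP => /det0P[x x0 xG]; move/negP : x0; apply; apply/eqP.
  have : \sum_i x 0 i *: l i s = 0.
    apply: euclid_eq0; rewrite euclid_sumr big1// => j _.
    rewrite euclidC euclidZl euclidC euclid_suml.
    have /rowP/(_ j) := xG; rewrite !mxE => xG0.
    rewrite -[X in _ * X = _]/(_) (_ : \sum_i _ = 0) ?mulr0// -[RHS]xG0.
    by apply: eq_bigr => i _; rewrite mxE euclidZl.
  move=> xl; apply/rowP => k; rewrite mxE.
  by have := graph_coord dar (S s) (fun i => x 0 i) k; rewrite -/(l _ s) xl linear0r.
pose y i s := \sum_j invmx (G s) i j * euclid w (l j s).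
have sy i : smooth_within J (y i).
  have sGi := smooth_invmx pJ sG (fun s _ => G0 s).
  apply: (smooth_sum pJ) => j _; apply: (smoothM pJ); first exact: sGi.
  exact: smooth_euclid pJ (smooth_curve_cst pJ (w := w)) (sl j).
have lL i s : J s -> l i s \in Lam s.
  by move=> Js; apply: graph_vec_mem; exact: gS.
have yL s : J s -> \sum_i y i s *: l i s \in Lam s.
  by move=> Js; apply: memv_suml => i _; rewrite memvZ// lL.
have projE s : J s -> orthoproj (Lam s) w = \sum_i y i s *: l i s.
  move=> Js; apply: orthoprojP; first exact: yL.
  move=> z /(is_graphP (gS Js))[x ->].
  rewrite euclid_sumr big1// => k _; rewrite euclidC euclidZl euclidC -/(l k s).
  suff -> : euclid (w - \sum_i y i s *: l i s) (l k s) = 0 by rewrite mulr0.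
  rewrite euclidBl euclid_suml; apply/eqP; rewrite subr_eq0 eq_sym; apply/eqP.
  transitivity ((G s *m (invmx (G s) *m \col_j euclid w (l j s))) k 0).
    rewrite mxE; apply: eq_bigr => i _; rewrite euclidZl mulrC !mxE euclidC.
    by congr (_ * _); apply: eq_bigr => j _; rewrite mxE.
  by rewrite mulKVmx ?mxE// unitmxE unitfE.
split=> [|s Js]; last by rewrite projE// yL.
apply: (smooth_curve_eq projE).
apply: (smooth_curve_sum pJ) => i; exact (smooth_curveZ pJ (sy i) (sl i)).
Qed.

End ChartSections.

(** * The velocity in a chart *)

Section RankOneMatrices.
Context {F : fieldType} {m : nat}.
Implicit Type M : 'M[F]_m.

Lemma rank1_minor M i j k l : \rank M = 1%N -> M i j * M k l = M i l * M k j.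
Proof.
have := mulmx_base M; move: (col_base M) (row_base M).
case: (\rank M) => [//|[|//]] C D <- _.
by rewrite !mxE !big_ord1; ring.
Qed.

(** If the diagonal vanishes, so do all the entries, by the minors
    M i j M j i = M i i M j j. *)
Lemma rank1_symmetric_diag M : M^T = M -> \rank M = 1%N -> exists i, M i i != 0.
Proof.
move=> sM rM; apply/existsP; rewrite -[X in is_true X]negbK negb_exists.
apply/negP => /forallP M0.
have : M = 0.
  apply/matrixP => i j; rewrite mxE; apply/eqP; rewrite -[_ == 0]orbb -mulf_eq0.
  have Mij : M j i = M i j by rewrite -{1}sM mxE.
  rewrite -{2}Mij (rank1_minor _ _ _ _ rM).
  by have /negPn/eqP -> := M0 i; rewrite mul0r.
by move=> M0'; move: rM; rewrite M0' mxrank0.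
Qed.

End RankOneMatrices.

Section ChartVelocity.
Context {R : realType} {W : vectType R} {m : nat}.
Variable sigma : {skew_symmetric W}.
Variables (I J : set R) (Lam : R -> {vspace W}).
Variables (e f : 'I_m -> W) (S : R -> 'M[R]_m).
Hypothesis pI : proper_interval I.
Hypothesis isoL : forall t, I t -> {in Lam t &, forall u v, sigma u v = 0}.
Hypothesis sections : forall t w, I t -> w \in Lam t -> exists c : R -> W,
  [/\ smooth_curve I c, forall s, I s -> c s \in Lam s & c t = w].
Hypothesis dar : darboux_basis sigma e f.
Hypothesis oJ : rel_open J I.
Hypothesis pJ : proper_interval J.
Hypothesis symS : forall s, J s -> (S s)^T = S s.
Hypothesis gS : forall s, J s -> is_graph e f (S s) (Lam s).
Hypothesis sS : smooth_entries J S.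

Local Notation q := (velocity sigma I Lam).

Let slv i : smooth_curve J (fun s => graph_vec e f (S s) i).
Proof. exact: smooth_graph_vec. Qed.
Arguments slv : clear implicits.

Definition chart_derive t : 'M[R]_m :=
  \matrix_(i, j) derive_within J (fun s => S s i j) t.

Lemma chart_derive_sym t : J t -> (chart_derive t)^T = chart_derive t.
Proof.
move=> Jt; apply/matrixP => i j; rewrite !mxE.
by apply: derive_within_eq => // s Js; rewrite -[in RHS]symS// mxE.
Qed.

(** Compare with the curve that has constant coordinates in the moving basis of
    the graph.  The velocity being defined through curves on the whole of I,
    one needs such a curve through every vector of Lam t. *)
Lemma velocity_chart t (x : 'I_m -> R) : J t ->
  q t (\sum_i x i *: graph_vec e f (S t) i) =
  \sum_i \sum_k x i * x k * chart_derive t k i.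
Proof.
move=> Jt; set w := (X in q t X).
have It := oJ.1 _ Jt.
have wL : w \in Lam t.
  by apply: memv_suml => i _; rewrite memvZ// (graph_vec_mem _ (gS Jt)).
have [c [sc cL ct]] := sections It wL.
pose d s := \sum_i x i *: graph_vec e f (S s) i.
have sl i : smooth_curve J (fun s => x i *: graph_vec e f (S s) i).
  exact (smooth_curveZc (a := x i) pJ (slv i)).
have sd : smooth_curve J d by exact: (smooth_curve_sum pJ).
have dL s : J s -> d s \in Lam s.
  move=> Js; apply: memv_suml => i _.
  by rewrite memvZ// (graph_vec_mem _ (gS Js)).
rewrite -ct (velocityE pI isoL sc cL It).
rewrite -(curve_derive_local (c := c) oJ (fun _ _ => erefl) Jt).
have scJ := smooth_curve_local oJ (fun _ _ => erefl) sc.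
rewrite (velocity_indep isoL pJ oJ.1 scJ sd (fun s Js => cL s (oJ.1 _ Js)) dL Jt ct).
rewrite /d (curve_derive_sum pJ _ Jt sl) skew_suml; apply: eq_bigr => i _.
rewrite (curve_deriveZc pJ (x i) (slv i) Jt) derive_graph_vec//.
rewrite skewZl skew_suml big_distrr /=; apply: eq_bigr => k _.
by rewrite skewZl (graph_coord dar) mxE; ring.
Qed.

Lemma polar_chart t (x y : 'I_m -> R) : J t ->
  polar_form (q t) (\sum_i x i *: graph_vec e f (S t) i)
    (\sum_i y i *: graph_vec e f (S t) i) =
  \sum_i \sum_k x i * y k * chart_derive t i k.
Proof.
move=> Jt; rewrite /polar_form.
have -> : \sum_i x i *: graph_vec e f (S t) i +
    \sum_i y i *: graph_vec e f (S t) i =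
    \sum_i (x i + y i) *: graph_vec e f (S t) i.
  by rewrite -big_split; apply: eq_bigr => i _; rewrite /= scalerDl.
rewrite !velocity_chart//; set M := chart_derive t.
have symM i k : M k i = M i k by rewrite /M -{1}(chart_derive_sym Jt) mxE.
have -> : \sum_i \sum_k (x i + y i) * (x k + y k) * M k i =
    \sum_i \sum_k x i * x k * M k i + \sum_i \sum_k y i * y k * M k i +
    (\sum_i \sum_k x i * y k * M i k + \sum_i \sum_k x i * y k * M i k).
  have swap : \sum_i \sum_k x i * y k * M i k =
      \sum_i \sum_k x k * y i * M k i by rewrite exchange_big.
  rewrite {2}swap -!big_split; apply: eq_bigr => i _ /=.
  rewrite -!big_split; apply: eq_bigr => k _ /=.
  by rewrite (symM i k); ring.
by field.
Qed.

(** The matrices of the same symmetric bilinear form in two bases of Lam t: the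
    reference one and the basis of the graph. *)
Lemma rank_chart_derive t : J t -> qform_rank (Lam t) (q t) = 1%N ->
  \rank (chart_derive t) = 1%N.
Proof.
move=> Jt; rewrite /qform_rank; set P := \matrix_(_, _) _ => rP.
set M := chart_derive t.
pose b (a : 'I_(\dim (Lam t))) := tnth (vbasis (Lam t)) a.
pose X : 'M[R]_(\dim (Lam t), m) := \matrix_(a, i) sigma (f i) (b a).
pose Y : 'M[R]_(m, \dim (Lam t)) :=
  \matrix_(i, a) coord (vbasis (Lam t)) a (graph_vec e f (S t) i).
have bX a : b a = \sum_i X a i *: graph_vec e f (S t) i.
  have /(is_graphP (gS Jt))[x bx] : b a \in Lam t.
    by apply: vbasis_mem; exact: mem_tnth.
  rewrite bx; apply: eq_bigr => i _; congr (_ *: _).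
  by rewrite mxE bx (graph_coord dar).
have lY i : graph_vec e f (S t) i = \sum_a Y i a *: b a.
  rewrite {1}(coord_vbasis (graph_vec_mem i (gS Jt))).
  by apply: eq_bigr => a _; rewrite mxE /b (tnth_nth 0).
have PX : P = X *m M *m X^T.
  apply/matrixP => a a'; rewrite !mxE -/(b a) -/(b a') (bX a) (bX a').
  rewrite polar_chart// exchange_big; apply: eq_bigr => k _ /=.
  rewrite [X^T _ _]mxE [(X *m M) _ _]mxE big_distrl; apply: eq_bigr => i _ /=.
  by rewrite mulrAC.
have YX : Y *m X = 1%:M.
  apply/matrixP => i j; rewrite !mxE eq_sym -(skew_dual_graph dar (S t)).
  rewrite (lY i) skew_sumr; apply: eq_bigr => a _.
  by rewrite skewZr [X _ _]mxE.
have MP : M = Y *m P *m Y^T.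
  by rewrite PX !mulmxA YX mul1mx -mulmxA -trmx_mul YX trmx1 mulmx1.
apply/eqP; rewrite eqn_leq; apply/andP; split; rewrite -rP.
  by rewrite {1}MP; apply: leq_trans (mxrankM_maxl _ _) (mxrankM_maxr _ _).
by rewrite PX; apply: leq_trans (mxrankM_maxl _ _) (mxrankM_maxr _ _).
Qed.

(** Near t0 some diagonal entry of the derivative does not vanish, and the
    corresponding column, suitably normalized, is the required factor. *)
Lemma chart_derive_factor t0 : J t0 ->
  (forall t, J t -> qform_rank (Lam t) (q t) = 1%N) ->
  exists (J1 : set R) (sg : R) (v : 'I_m -> R -> R),
    [/\ rel_open J1 J, is_interval J1, J1 t0, sg ^+ 2 = 1 &
      (forall i, smooth_within J1 (v i)) /\
      forall s i j, J1 s -> chart_derive s i j = sg * v i s * v j s].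
Proof.
move=> Jt0 rk.
have [i0 Mi0] := rank1_symmetric_diag (chart_derive_sym Jt0)
  (rank_chart_derive Jt0 (rk _ Jt0)).
pose D i j := derive_within J (fun s => S s i j).
have sD i j : smooth_within J (D i j) by exact: smooth_within_derive.
have DE s i j : chart_derive s i j = D i j s by rewrite mxE.
pose sg : R := Num.sg (D i0 i0 t0).
have sg1 : sg ^+ 2 = 1 by rewrite sqr_sg -DE Mi0.
have pos0 : 0 < sg * D i0 i0 t0.
  by rewrite /sg -normrEsg normr_gt0 -DE.
have FF := within_dnbhs_proper pJ Jt0.
have sgD : smooth_within J (fun s => sg * D i0 i0 s) by exact: smoothZ.
have [r r0 Hr] := near_within_ball pos0
  (cvgr_gt _ (smooth_cvg pJ sgD Jt0) _ pos0).
pose J1 := J `&` ball t0 r.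
have oJ1 : rel_open J1 J by apply: rel_open_setI; exact: ball_open.
have pJ1 : proper_interval J1 by exact: proper_interval_ball.
have pos s : J1 s -> 0 < sg * D i0 i0 s by case=> Js bs; exact: Hr.
have sDJ1 i j := smooth_within_local oJ1 (fun _ _ => erefl) (sD i j).
have sgDJ1 := smooth_within_local oJ1 (fun _ _ => erefl) sgD.
have ssqrt := smooth_sqrt pJ1 pos sgDJ1.
exists J1, sg, (fun i s => D i0 i s * (Num.sqrt (sg * D i0 i0 s))^-1).
split; [exact: oJ1|exact: pJ1.1|by split => //; exact: ballxx|exact: sg1|].
split=> [i|s i j J1s].
  apply: (smoothM pJ1 (sDJ1 i0 i)); apply: (smoothV pJ1 _ ssqrt) => s J1s.
  by rewrite gt_eqF// sqrtr_gt0 pos.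
have Js := oJ1.1 _ J1s.
have rkM := rank_chart_derive Js (rk _ Js).
have := rank1_minor i0 i0 i j rkM.
have -> : chart_derive s i i0 = D i0 i s by rewrite -(chart_derive_sym Js) !mxE.
rewrite !DE => minor.
have D0 : D i0 i0 s != 0.
  by apply/eqP => D0; have := pos s J1s; rewrite D0 mulr0 ltxx.
have sg0 : sg != 0 by apply/eqP => sg0; have := pos s J1s; rewrite sg0 mul0r ltxx.
set r' := Num.sqrt _.
have r2 : r' ^+ 2 = sg * D i0 i0 s by rewrite sqr_sqrtr// ltW// pos.
apply: (mulfI D0); rewrite minor.
have -> : D i0 i0 s * (sg * (D i0 i s / r') * (D i0 j s / r')) =
   (sg * D i0 i0 s) / r' ^+ 2 * (D i0 j s * D i0 i s).
  by rewrite expr2 invfM; ring.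
by rewrite r2 mulfV ?mul1r// mulf_neq0.
Qed.

End ChartVelocity.

(** * Generating curves and weights in a chart *)

Section LocalGenerating.
Context {R : realType} {W : vectType R} {m : nat}.
Variable sigma : {skew_symmetric W}.
Variables (J : set R) (Lam : R -> {vspace W}).
Variables (e f : 'I_m -> W) (S : R -> 'M[R]_m).
Variables (sg : R) (v : 'I_m -> R -> R).
Hypothesis m_gt0 : (0 < m)%N.
Hypothesis dar : darboux_basis sigma e f.
Hypothesis pJ : proper_interval J.
Hypothesis gS : forall s, J s -> is_graph e f (S s) (Lam s).
Hypothesis symS : forall s, J s -> (S s)^T = S s.
Hypothesis sS : smooth_entries J S.
Hypothesis sg1 : sg ^+ 2 = 1.
Hypothesis sv : forall i, smooth_within J (v i).
Hypothesis dS : forall s i j, J s ->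
  derive_within J (fun u => S u i j) s = sg * v i s * v j s.
Hypothesis detV : forall s, J s -> \det (wronskian J v s) != 0.

Let l i s := graph_vec e f (S s) i.
Let slv i : smooth_curve J (l i).
Proof. exact: smooth_graph_vec. Qed.
Arguments slv : clear implicits.

Let imax_lt : (m.-1 < m)%N. Proof. by rewrite prednK. Qed.
Let imax : 'I_m := Ordinal imax_lt.

Let sV : smooth_entries J (wronskian J v).
Proof.
by move=> i j; under eq_fun do rewrite mxE; exact: smooth_derive_n.
Qed.

(* x s is orthogonal to the derivatives of v at s of order less than m - 1, and
   its product with the one of order m - 1 is 1. *)
Let x i s := invmx (wronskian J v s)^T i imax.

Let sx i : smooth_within J (x i).
Proof.
apply: (smooth_invmx pJ); first by apply: smooth_trmx; exact: sV.
by move=> s Js; rewrite det_tr detV.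
Qed.
Arguments sx : clear implicits.

Let Dx j i : R -> R := derive_within_n J j (x i).
Let Dv p i : R -> R := derive_within_n J p (v i).

Let sDx j i : smooth_within J (Dx j i).
Proof. exact: smooth_derive_n. Qed.
Arguments sDx : clear implicits.

Let sDv p i : smooth_within J (Dv p i).
Proof. exact: smooth_derive_n. Qed.
Arguments sDv : clear implicits.

(* The products of the derivatives of v and x; they are constant for
   p + j < m, as one sees by moving derivatives from x to v. *)
Let pairing p j s := \sum_i Dv p i s * Dx j i s.

Let pairing0 p s : J s -> (p < m)%N -> pairing p 0 s = (p == m.-1)%:R.
Proof.
move=> Js pm.
have : (wronskian J v s)^T *m invmx (wronskian J v s)^T = 1%:M.
  by rewrite mulmxV// unitmxE unitfE det_tr detV.
move=> /matrixP/(_ (Ordinal pm) imax); rewrite !mxE => <-.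
by apply: eq_bigr => i _; rewrite !mxE.
Qed.

Let derive_pairing p j s : J s ->
  derive_within J (pairing p j) s = pairing p.+1 j s + pairing p j.+1 s.
Proof.
move=> Js; rewrite /pairing -big_split (derive_within_sum pJ)//; last first.
  by move=> i _; exact: smoothM pJ _ _ (sDv p i) (sDx j i).
apply: eq_bigr => i _ /=.
exact: derive_withinM (sDv p i) (sDx j i) Js.
Qed.

Let pairingE p j s : J s -> (p + j < m)%N ->
  pairing p j s = if (p + j == m.-1)%N then (-1) ^+ j else 0.
Proof.
elim: j p s => [|j IH] p s Js pj.
  by rewrite addn0 in pj *; rewrite pairing0// expr0; case: eqP.
have pj' : (p + j < m)%N by apply: ltn_trans pj; rewrite addnS.
have cst : derive_within J (pairing p j) s = 0.
  rewrite (derive_within_eq (g := fun=> if (p + j == m.-1)%N then (-1) ^+ j else 0) _ Js).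
    exact: derive_within_cst.
  by move=> u Ju; rewrite IH.
have := derive_pairing p j Js; rewrite cst IH//; last by rewrite addSnnS.
move=> /esym/eqP; rewrite addrC addr_eq0 => /eqP ->.
by rewrite addSnnS; case: eqP => _; rewrite ?oppr0// exprS mulN1r.
Qed.

Let c s := \sum_i x i s *: l i s.
Let cj j s := \sum_i Dx j i s *: l i s.
Let n s := \sum_k v k s *: f k.

Let smooth_term j i : smooth_curve J (fun s => Dx j i s *: l i s).
Proof. exact (smooth_curveZ pJ (sDx j i) (slv i)). Qed.
Arguments smooth_term : clear implicits.

Let scj j : smooth_curve J (cj j).
Proof. by apply: (smooth_curve_sum pJ) => i; exact: smooth_term. Qed.

Let derive_cj j s : J s ->
  curve_derive J (cj j) s = cj j.+1 s + (sg * pairing 0 j s) *: n s.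
Proof.
move=> Js; rewrite /cj (curve_derive_sum pJ _ Js (smooth_term j)).
rewrite /pairing big_distrr scaler_suml -big_split; apply: eq_bigr => i _ /=.
rewrite (curve_deriveZ pJ (sDx j i) (slv i) Js); congr (_ + _).
rewrite (derive_graph_vec e f pJ sS i Js) /n !scaler_sumr.
apply: eq_bigr => k _; rewrite dS// !scalerA; congr (_ *: _).
by rewrite /Dv /=; ring.
Qed.

Let derive_nc j s : J s -> (j < m)%N -> curve_derive_n J j c s = cj j s.
Proof.
elim: j s => [//|j IH] s Js jm /=.
rewrite (curve_derive_eq (d := cj j) _ Js); last first.
  by move=> u Ju; rewrite IH// ltnW.
rewrite derive_cj// pairingE ?add0n ?(ltnW jm)//.
have -> : (j == m.-1)%N = false by apply/eqP; lia.
by rewrite mulr0 scale0r addr0.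
Qed.

(** Let c be the point of the graph over x, where x is orthogonal to the
    derivatives of v of order less than m - 1.  Since S' = sg v v^T, the term
    with S' in the derivative of c^(j) contains the product of v with x^(j),
    which is 0 for j < m - 1 and 1 or -1 for j = m - 1. *)
Lemma local_generating : exists c : R -> W, generating (m := m) sigma Lam J c.
Proof.
exists c; split.
- exact: (scj (j := 0)).
- move=> s Js j jm; rewrite derive_nc//; apply: memv_suml => i _.
  by rewrite memvZ// (graph_vec_mem _ (gS Js)).
move=> s Js; rewrite (derive_nc Js imax_lt).
have -> : curve_derive_n J m c s = cj m s + (sg * (-1) ^+ m.-1) *: n s.
  rewrite -[in LHS](prednK m_gt0) /= (curve_derive_eq (d := cj m.-1) _ Js).
    rewrite derive_cj// pairingE ?add0n ?eqxx// prednK//.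
  by move=> u Ju; rewrite derive_nc.
have ll i j : sigma (l i s) (l j s) = 0.
  by rewrite /l (skew_graph dar) -{2}(symS Js) mxE subrr.
have nl j : sigma (n s) (l j s) = v j s.
  rewrite /n skew_suml (bigD1 j)//= skewZl (skew_dual_graph dar) eqxx mulr1.
  rewrite big1 ?addr0// => k kj; rewrite skewZl (skew_dual_graph dar).
  by rewrite (negPf kj) mulr0.
rewrite skewDl skewZl {1}/cj skew_suml big1 ?add0r; last first.
  move=> i _; rewrite skewZl /cj skew_sumr big1 ?mulr0// => j _.
  by rewrite skewZr ll mulr0.
have -> : sigma (n s) (cj m.-1 s) = pairing 0 m.-1 s.
  rewrite /cj skew_sumr; apply: eq_bigr => j _.
  by rewrite skewZr nl mulrC.
rewrite pairingE// add0n eqxx -mulrA -expr2 sqrr_sign mulr1.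
exact: sg1.
Qed.

End LocalGenerating.

Section WeightInCharts.
Context {R : realType} {W : vectType R} {m : nat}.
Variable sigma : {skew_symmetric W}.
Variables (I : set R) (Lam : R -> {vspace W}).
Hypothesis pI : proper_interval I.

(** Expressed by a limit, an order of vanishing is unchanged by a
    multiplication by a continuous nonvanishing function, hence by a change of
    chart. *)
Definition order_at k (S : R -> 'M[R]_m) t := exists2 a : R, a != 0 &
  \det (S s - S t) / (s - t) ^+ k @[s --> within I t^'] --> a.

Lemma weight_chart t k : I t -> has_weight (m := m) sigma I Lam t k ->
  exists (J : set R) e f S, [/\ [/\ rel_open J I, is_interval J & J t],
    darboux_basis sigma e f,
    forall s, J s -> (S s)^T = S s /\ is_graph e f (S s) (Lam s),
    smooth_entries J S & order_at k S t].
Proof.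
move=> It [r [e [f [S [[r0 dar gS sS] [h0 hk]]]]]].
pose J := I `&` ball t r.
have oJ : rel_open J I by apply: rel_open_setI; exact: ball_open.
have pJ : proper_interval J by exact: proper_interval_ball.
have Jt : J t by split => //; exact: ballxx.
have sSe : smooth_entries J S by apply/(smooth_within_entries _ pJ).
exists J, e, f, S; split; [by split; [|exact: pJ.1|]|exact: dar|exact: gS|exact: sSe|].
have sh : smooth_within J (fun s => \det (S s - S t)).
  apply: (smooth_det pJ) => i j; under eq_fun do rewrite !mxE.
  exact: smoothB (sSe i j) (smooth_cst pJ _).
have := taylor_cvg pJ Jt sh h0.
rewrite (within_dnbhs_rel_open oJ Jt) => H; eexists; last exact: H.
by rewrite mulf_neq0// invr_eq0 pnatr_eq0 gtn_eqF// fact_gt0.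
Qed.

Section ChartChange.
Variables (J1 J2 : set R) (e1 f1 e2 f2 : 'I_m -> W) (S1 S2 : R -> 'M[R]_m).
Variables (t : R) (k : nat).
Hypotheses (oJ1 : rel_open J1 I) (oJ2 : rel_open J2 I).
Hypothesis pJ1 : proper_interval J1.
Hypotheses (J1t : J1 t) (J2t : J2 t).
Hypotheses (dar1 : darboux_basis sigma e1 f1) (dar2 : darboux_basis sigma e2 f2).
Hypothesis gS1 : forall s, J1 s -> (S1 s)^T = S1 s /\ is_graph e1 f1 (S1 s) (Lam s).
Hypothesis gS2 : forall s, J2 s -> (S2 s)^T = S2 s /\ is_graph e2 f2 (S2 s) (Lam s).
Hypothesis sS1 : smooth_entries J1 S1.

(** The pairings between bases of Lam s and Lam t form the matrix S s - S t;
    changing the chart multiplies it by transition matrices. *)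
Lemma order_at_chart_change : order_at k S2 t -> order_at k S1 t.
Proof.
move=> [a a0 ha].
pose l1 i s := graph_vec e1 f1 (S1 s) i; pose l2 i s := graph_vec e2 f2 (S2 s) i.
pose T s : 'M[R]_m := \matrix_(i, j) sigma (f2 j) (l1 i s).
have l1E s i : J1 s -> J2 s -> l1 i s = \sum_j T s i j *: l2 j s.
  move=> J1s J2s.
  have /(is_graphP (gS2 J2s).2)[y yE] := graph_vec_mem i (gS1 J1s).2.
  rewrite /l1 yE; apply: eq_bigr => j _; congr (_ *: _).
  by rewrite mxE /l1 yE (graph_coord dar2).
have S1E s : J1 s -> J2 s -> S1 s - S1 t = T s *m (S2 s - S2 t) *m (T t)^T.
  move=> J1s J2s; apply/matrixP => i j.
  have -> : (S1 s - S1 t) i j = sigma (l1 i s) (l1 j t).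
    by rewrite (skew_graph dar1) -{1}(gS1 J1s).1 !mxE.
  rewrite (l1E s i J1s J2s) (l1E t j J1t J2t) skew_sumr mxE.
  apply: eq_bigr => p _; rewrite skewZr skew_suml mulrC.
  rewrite [(T t)^T _ _]mxE [(T s *m _) _ _]mxE; congr (_ * _).
  apply: eq_bigr => r _; rewrite skewZl (skew_graph dar2).
  by rewrite -{1}(gS2 J2s).1 !mxE.
have sT : smooth_entries J1 T.
  move=> i j; under eq_fun do rewrite mxE.
  have sl1 : smooth_curve J1 (l1 i) by exact: smooth_graph_vec.
  exact (smooth_skew (sigma := sigma) pJ1 (smooth_curve_cst pJ1 (w := f2 j)) sl1).
have T0 : \det (T t) != 0.
  rewrite -unitfE -unitmxE.
  pose U : 'M[R]_m := \matrix_(i, j) sigma (f1 j) (l2 i t).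
  suff /mulmx1_unit[] : T t *m U = 1%:M by [].
  apply/matrixP => i j; rewrite !mxE eq_sym -(skew_dual_graph dar1 (S1 t)).
  rewrite -/(l1 i t) (l1E t i J1t J2t) skew_sumr; apply: eq_bigr => r _.
  by rewrite skewZr [U _ _]mxE.
have It := oJ1.1 _ J1t; have FF := within_dnbhs_proper pI It.
have dT : \det (T s) @[s --> within I t^'] --> \det (T t).
  by rewrite -(within_dnbhs_rel_open oJ1 J1t); exact: smooth_cvg (smooth_det pJ1 sT) J1t.
have cc : (fun=> \det (T t)) @ within I t^' --> \det (T t) by exact: cvg_cst.
exists (\det (T t) * a * \det (T t)); first by rewrite !mulf_neq0.
apply: cvg_near_eq (cvgM (cvgM dT ha) cc).
have n1 : within I t^' J1 by apply: nbhs_dnbhs; exact: oJ1.2.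
have n2 : within I t^' J2 by apply: nbhs_dnbhs; exact: oJ2.2.
apply: filterS2 n1 n2 => s J1s J2s.
change (\det (T s) * (\det (S2 s - S2 t) / (s - t) ^+ k) * \det (T t) =
  \det (S1 s - S1 t) / (s - t) ^+ k).
by rewrite S1E// !det_mulmx det_tr; ring.
Qed.

End ChartChange.

End WeightInCharts.

(** * Existence and uniqueness of the normal frame *)

Lemma psymplectic_nondeg {R : realType} {W : vectType R}
    (sigma : {skew_symmetric W}) : is_psymplectic sigma ->
  forall w, (forall v, sigma w v = 0) -> w = 0.
Proof.
move=> [/eqP nd _ _] w w0; apply/eqP; rewrite -memv0 -nd.
by apply/mem_orthovP => v _; exact: w0.
Qed.

Section ExistenceOfGeneratingCurve.
Context {R : realType} {W : vectType R} {m : nat}.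
Variable sigma : {skew_symmetric W}.
Variables (I : set R) (Lam : R -> {vspace W}) (k : nat).
Hypothesis m_gt0 : (0 < m)%N.
Hypothesis dimW : \dim {:W} = (2 * m)%N.
Hypothesis nondeg : forall w, (forall v, sigma w v = 0) -> w = 0.
Hypothesis pI : proper_interval I.
Hypothesis isoL : forall t, I t -> {in Lam t &, forall u v, sigma u v = 0}.
Hypothesis rank1 : rank1_curve sigma I Lam.
Hypothesis weight : forall t, I t -> has_weight (m := m) sigma I Lam t k.

(** Orthogonal projections of w: where no curve defined on the whole of I passes
    through w, the velocity takes the default value 0, so the rank hypothesis
    would say nothing about the chart. *)
Lemma curve_sections t w : I t -> w \in Lam t -> exists c : R -> W,
  [/\ smooth_curve I c, forall s, I s -> c s \in Lam s & c t = w].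
Proof.
move=> It wL; exists (fun s => orthoproj (Lam s) w).
have loc s : I s -> exists J : set R, [/\ rel_open J I, J s,
    smooth_curve J (fun u => orthoproj (Lam u) w) &
    forall u, J u -> orthoproj (Lam u) w \in Lam u].
  move=> Is; have := weight_chart pI Is (weight Is).
  move=> [J [e [f [S [[oJ iJ Js] dar gS sS _]]]]]; exists J.
  have pJ := rel_open_proper pI oJ iJ (ex_intro _ s Js).
  have [sP PL] := smooth_orthoproj dar pJ (fun u Ju => (gS u Ju).2) sS w.
  by split.
split.
- apply: smooth_curve_glue => s /loc[J [oJ Js sP _]].
  by exists J, (fun u => orthoproj (Lam u) w); split.
- by move=> s /loc[J [_ Js _ PL]]; exact: PL.
- apply: orthoprojP => // z _.
  by rewrite subrr -(scale0r 0) euclidZl mul0r.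
Qed.

Lemma generating_near t : I t -> exists J c,
  [/\ rel_open J I, is_interval J, J t & generating (m := m) sigma Lam J c].
Proof.
move=> It; have := weight_chart pI It (weight It).
move=> [J [e [f [S [[oJ iJ Jt] dar gS sS _]]]]].
have pJ := rel_open_proper pI oJ iJ (ex_intro _ t Jt).
have [J1 [sg [v [oJ1 iJ1 J1t sg1 [sv dS]]]]] :=
  chart_derive_factor pI isoL curve_sections dar oJ pJ
    (fun s Js => (gS s Js).1) (fun s Js => (gS s Js).2) sS Jt
    (fun s Js => rank1 (oJ.1 _ Js)).
have pJ1 := rel_open_proper pJ oJ1 iJ1 (ex_intro _ t J1t).
have oJ1I := rel_open_trans oJ1 oJ.
have gS1 s : J1 s -> is_graph e f (S s) (Lam s) by move=> /oJ1.1 /gS[].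
have symS1 s : J1 s -> (S s)^T = S s by move=> /oJ1.1 /gS[].
have sS1 := smooth_entries_local oJ1 sS.
have dS1 s i j : J1 s ->
    derive_within J1 (fun u => S u i j) s = sg * v i s * v j s.
  move=> J1s; rewrite -dS// mxE.
  exact: (derive_within_local oJ1 (fun _ _ => erefl) J1s).
(* The weight at s is given in a chart centred at s. *)
have ord s : J1 s -> exists2 a : R, a != 0 &
    \det (S u - S s) / (u - s) ^+ k @[u --> within J1 s^'] --> a.
  move=> J1s; have Js := oJ1.1 _ J1s; have Is := oJ.1 _ Js.
  have := weight_chart pI Is (weight Is).
  move=> [J2 [e2 [f2 [S2 [[oJ2 iJ2 J2s] dar2 gS2 sS2 ord2]]]]].
  rewrite (within_dnbhs_rel_open oJ1I J1s).
  exact: (order_at_chart_change pI oJ oJ2 pJ Js J2s dar dar2 gS gS2 sS ord2).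
have sg0 : sg != 0 by rewrite -sqrf_eq0 sg1 oner_eq0.
have W0 := wronskian_neq0 pJ1 sg0 sS1 sv dS1 ord.
have [c gc] := local_generating m_gt0 dar pJ1 gS1 symS1 sS1 sg1 sv dS1 W0.
by exists J1, c.
Qed.

Lemma normal_frame_exists : (forall t, I t -> \dim (Lam t) = m) ->
  exists E F : 'I_m -> R -> W, normal_darboux_frame sigma I Lam E F.
Proof.
move=> dimL.
have [c gc] := generating_exists m_gt0 dimW nondeg pI isoL generating_near.
have [sc _ c1] := gc.
have sp := smooth_skew (sigma := sigma) pI
  (smooth_curve_derive_n (n := m) pI sc) (smooth_curve_derive_n (n := m.-1) pI sc).
have [s s1 sE] := smooth_sqr1_cst pI sp c1.
exists (@generated_frame _ _ m I c), (@dual_frame _ _ m sigma I c s).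
exact: generated_normal_frame.
Qed.

End ExistenceOfGeneratingCurve.

Theorem theorem2 (R : realType) (W : vectType R) (m : nat)
    (sigma : {skew_symmetric W})
    (hdim : \dim {:W} = (2 * m)%N)
    (hsigma : is_psymplectic sigma)
    (I : set R) (hI : is_interval I)
    (hI_nondeg : exists a b, [/\ I a, I b & a < b])
    (Lam : R -> {vspace W})
    (hsmooth : smooth_lagrangian_curve m sigma I Lam)
    (hrank : rank1_curve sigma I Lam)
    (hweight : constant_finite_weight m sigma I Lam) :
  (exists E F : 'I_m -> R -> W, normal_darboux_frame sigma I Lam E F) /\
  (forall E F : 'I_m -> R -> W, normal_darboux_frame sigma I Lam E F ->
    forall E' F' : 'I_m -> R -> W,
      (normal_darboux_frame sigma I Lam E' F' /\ ~ same_frame_on I E F E' F')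
      <-> same_frame_on I (fun i t => - E i t) (fun i t => - F i t) E' F').
Proof.
have pI : proper_interval I by split.
have nondeg := psymplectic_nondeg hsigma.
have isoL t : I t -> {in Lam t &, forall u v, sigma u v = 0}.
  by move=> /(hsmooth.1)[].
have dimL t : I t -> \dim (Lam t) = m by move=> /(hsmooth.1)[].
have [t0 [_ [It0 _ _]]] := hI_nondeg.
have m_gt0 : (0 < m)%N.
  by rewrite -(dimL t0 It0) -(hrank t0 It0) rank_leq_row.
have [k weight] := hweight.
split; first exact: (normal_frame_exists m_gt0 hdim nondeg pI isoL hrank weight dimL).
move=> E F nEF E' F'; split=> [[nEF' diff]|opp].
  have [a a1 EF'] := normal_frame_unique m_gt0 hdim nondeg pI isoL nEF nEF'.
  move/eqP : a1; rewrite sqrf_eq1 => /orP[] /eqP a_1; rewrite a_1 in EF'.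
    exfalso; apply: diff => t It i.
    by have [-> ->] := EF' t It i; rewrite !scale1r.
  by move=> t It i; have [-> ->] := EF' t It i; rewrite !scaleN1r.
split.
  apply: (normal_frameZ hdim pI dimL (a := -1) _ nEF).
    by rewrite sqrrN expr1n.
  by move=> t It i; have [-> ->] := opp t It i; rewrite !scaleN1r.
move=> same; pose i0 := Ordinal m_gt0.
have [[_ _ dEF] _ _] := nEF; have [_ _ _ FE] := dEF t0 It0.
have [Eo _] := opp t0 It0 i0; have [Es _] := same t0 It0 i0.
have FEN : sigma (F i0 t0) (E i0 t0) = - sigma (F i0 t0) (E i0 t0).
  by rewrite -{1}Es Eo skewNr.
by move: FEN; rewrite FE eqxx /=; lra.
Qed.
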